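(* Let $U$ be a finite universe, let $z,k\ge 1$ be integers with $|U|=zk$, let $S_1,\dots,S_z\subseteq U$ with $|S_i|\le k$ for all $i$, and let $0<\varepsilon<1$. One can deterministically construct an $(\{S_i\},(1-\varepsilon)w)$-superimposed code of weight $w=\mathcal{O}(\varepsilon^{-1}\log^2|U|)$ and length $\ell=\mathcal{O}(\varepsilon^{-2}k\log^5|U|)$ in $\mathcal{O}(\varepsilon^{-1}|U|\log^2|U|)$ time and space.
   Context: Let $S_1,\dots,S_z$ be subsets of a universe $U$. A family of sets $\mathcal{C}=\{C_u: u\in U\}$ with $C_u\subseteq[\ell]=\{1,\dots,\ell\}$ and $|C_u|=w$ for all $u\in U$ is called an $(\{S_i\},\tau)$-superimposed code if for every $i$ and every $u\notin S_i$ we have $|C_u\setminus\bigcup_{v\in S_i}C_v|\ge\tau$. The numbers $\ell$ and $w$ are the length and the weight of the code. Computation is in the word RAM model; logarithms are base 2. *)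

(* Defs.v *)
From mathcomp Require Import all_boot all_order all_algebra.
From mathcomp Require Import reals exp.

Set Implicit Arguments.
Unset Strict Implicit.
Unset Printing Implicit Defensive.

Import Order.TTheory GRing.Theory Num.Theory.

Local Open Scope ring_scope.

Definition log2 (R : realType) (x : R) : R := ln x / ln 2%:R.

(* ({S_i}, tau)-superimposed code of weight w and length l; the ground set
   [l] = {1, ..., l} is 'I_l = {0, ..., l - 1}. *)
Definition superimposed_code (R : realType) (U : finType) (z w l : nat)
    (S : 'I_z -> {set U}) (tau : R) (C : U -> {set 'I_l}) : Prop :=
  (forall u, #|C u| = w) /\
  (forall i u, u \notin S i -> tau <= #|C u :\: \bigcup_(v in S i) C v|%:R).

Local Open Scope nat_scope.

(* Word RAM with W-bit words.  Words are the naturals below 2 ^ W.  A program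
   is a finite list of instructions, so it names finitely many registers; the
   memory is addressed indirectly through registers. *)
Inductive binop :=
  | OpAdd | OpSub | OpMul | OpDiv | OpMod | OpAnd | OpOr | OpXor | OpShl | OpShr | OpLtn | OpEqn.

Inductive instr :=
  | Const (r m : nat)            (* R[r] := m *)
  | Op (o : binop) (r x y : nat) (* R[r] := R[x] o R[y] *)
  | Read (r x : nat)             (* R[r] := M[R[x]] *)
  | Write (x y : nat)            (* M[R[x]] := R[y] *)
  | Jz (x q : nat).              (* if R[x] = 0 then goto q *)

Definition program := seq instr.

Record config := Config { pc : nat; regs : nat -> nat; memory : nat -> nat }.

Definition upd (f : nat -> nat) (i v : nat) : nat -> nat :=
  fun j => if j == i then v else f j.

(* As usual for %/ and %%, x / 0 = 0 and x mod 0 = x. *)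
Definition binop_sem (W : nat) (o : binop) (x y : nat) : nat :=
  match o with
  | OpAdd => x + y
  | OpSub => x + (2 ^ W - y)
  | OpMul => x * y
  | OpDiv => x %/ y
  | OpMod => x %% y
  | OpAnd => Nat.land x y
  | OpOr  => Nat.lor x y
  | OpXor => Nat.lxor x y
  | OpShl => x * 2 ^ y
  | OpShr => x %/ 2 ^ y
  | OpLtn => x < y
  | OpEqn => x == y
  end %% 2 ^ W.

(* The machine has the s memory cells 0, ..., s - 1: accessing any other
   address crashes (None).  It has halted once pc is outside the program. *)
Definition step (W s : nat) (P : program) (c : config) : option config :=
  let: Config p f m := c in
  match onth P p with
  | None => Some c
  | Some (Const r v) => Some (Config p.+1 (upd f r (v %% 2 ^ W)) m)
  | Some (Op o r x y) =>
      Some (Config p.+1 (upd f r (binop_sem W o (f x) (f y))) m)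
  | Some (Read r x) =>
      if f x < s then Some (Config p.+1 (upd f r (m (f x))) m) else None
  | Some (Write x y) =>
      if f x < s then Some (Config p.+1 f (upd m (f x) (f y))) else None
  | Some (Jz x q) => Some (Config (if f x == 0 then q else p.+1) f m)
  end.

Definition init (input : seq nat) : config :=
  Config 0 (fun=> 0) (fun i => nth 0 input i).

(* P, started with the input in memory (followed by zeros), halts within t
   steps in configuration c, using s memory cells (input included). *)
Definition computes (W s t : nat) (P : program) (input : seq nat)
    (c : config) : Prop :=
  [/\ size input <= s <= 2 ^ W,
      iter t (obind (step W s P)) (Some (init input)) = Some c
    & size P <= pc c].

Definition rank_word (U : finType) (u : U) : nat := enum_rank u.

(* The input is z, k, a, b (where the fraction a / b represents epsilon),
   followed for i = 1, ..., z by |S_i| and the elements of S_i, as listed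
   by L i.  Elements of U are named 0, ..., |U| - 1. *)
Definition code_input (U : finType) (z k a b : nat) (L : 'I_z -> seq U) :
    seq nat :=
  [:: z; k; a; b] ++
  flatten [seq size (L i) :: [seq rank_word u | u <- L i] | i <- enum 'I_z].

(* The output is w in cell 0, l in cell 1 and, in cell 2, the address of an
   array of |U| consecutive blocks of w words, the block of u listing C u. *)
Definition code_output (U : finType) (s w l : nat) (C : U -> {set 'I_l})
    (c : config) : Prop :=
  [/\ memory c 0 = w, memory c 1 = l, 3 <= s, memory c 2 + #|U| * w <= s
    & forall u, perm_eq [seq memory c (memory c 2 + rank_word u * w + j)
                          | j <- iota 0 w]
                        [seq nat_of_ord x | x <- enum (C u)]].

(* Main.v *)
Require Import Defs.
From mathcomp Require Import all_boot all_order all_algebra.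
From mathcomp Require Import reals exp.
From mathcomp Require Import zify lra.

(** The code.  Put L = floor(log |U|) + 1 and E = floor(b/a) + 1 >= 1/eps.  If
    z <= L^5 E^2, one private point per element is short enough.  Otherwise split U
    into B = Theta(k) buckets such that every S_i meets every bucket in at most
    L + 2 elements, and let the codeword of u consist of the triples
    (bucket of u, j, u mod p_j), where p_0 < p_1 < ... are the first w = E L (L + 3)
    primes.  Distinct elements agree modulo at most L primes, since the product
    of these primes divides their difference, so S_i covers at most
    L (L + 2) <= w / E of the w points of the codeword of an element outside S_i.
    By Chebyshev's bound on central binomial coefficients the primes are O(w L),
    whence the length.

    The buckets are found greedily.  The load of bucket b in S_i is charged
    2^load - 1, and every S_i keeps a binary tree of the sums of these charges.
    An element descends from the root to a leaf, always moving to the child whose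
    charge, summed over the sets containing the element, is smaller.  The leaf
    then carries at most 1/B of the charge of the roots, so that the total charge
    R satisfies B R <= k (R + z B) at the end, and R <= z B follows from 2k <= B. *)

Set Implicit Arguments.
Unset Strict Implicit.
Unset Printing Implicit Defensive.

Import Order.TTheory GRing.Theory Num.Theory.

(** * A structured language compiled to the word RAM *)

(** The threshold L^5 E^2 has two roles. Below it, the trivial length z k is within the required
    one. Above it, E < z <= |U| keeps the primes small, and plain trial division suffices to find
    them: their bound X is O(L^3 E), so that O(X^2) steps are O(L * L^5 E^2), hence O(L |U|). The
    sets containing u are reached through linked lists, and each costs O(1) steps per level of its
    tree. As the sets have at most z k = |U| elements in total and the trees have O(log |U|) levels,
    the greedy phase takes O(|U| log |U|) steps, which writing the output dominates; the trees
    occupy O(z B) = O(|U|) cells. Charges are 2^load - 1 and not 2^load so that empty trees are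
    zero, like the memory at the start, and need no initialisation. One fixed list of instructions
    must meet all bounds in machine steps. It is therefore written in a small structured language
    whose compiler is verified once, and time is carried along by rules for total correctness. Every
    number that occurs is below a fixed power of |U| + E, so it fits a word. *)

Inductive expr :=
  | Var (x : nat)
  | Cst (n : nat)
  | Bin (o : binop) (e1 e2 : expr)
  | Deref (e : expr).

Inductive cmd :=
  | Skip
  | Asg (x : nat) (e : expr)
  | Sto (e1 e2 : expr)
  | Seq (c1 c2 : cmd)
  | If (e : expr) (c1 c2 : cmd)
  | While (e : expr) (c : cmd).

(* Program variables are the registers below [tmp]; register [tmp] only ever
   receives 0, and the later ones hold the intermediate values of expressions. *)
Definition tmp := 30.

(** A variable is read in place at no cost, so the register of the result is returned with the code.
    Registers from [d] on are free. *)
Fixpoint compile_expr (e : expr) (d : nat) : program * nat :=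
  match e with
  | Var x => ([::], x)
  | Cst n => ([:: Const d n], d)
  | Bin o e1 e2 =>
      let: (p1, r1) := compile_expr e1 d in
      let: (p2, r2) := compile_expr e2 d.+1 in
      (p1 ++ p2 ++ [:: Op o d r1 r2], d)
  | Deref e1 => let: (p1, r1) := compile_expr e1 d in (rcons p1 (Read d r1), d)
  end.

Definition expr_code e d := (compile_expr e d).1.
Definition expr_reg e d := (compile_expr e d).2.

Definition goto (q : nat) : program := [:: Const tmp 0; Jz tmp q].

(** Jump targets are absolute, hence the offset [o] at which the code will lie. The machine has
    neither register moves nor unconditional jumps: a move adds the 0 put in [tmp], a jump tests
    it. *)
Fixpoint compile (c : cmd) (o : nat) : program :=
  match c with
  | Skip => [::]
  | Asg x e =>
      expr_code e tmp.+1 ++ [:: Const tmp 0; Op OpAdd x (expr_reg e tmp.+1) tmp]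
  | Sto e1 e2 =>
      expr_code e1 tmp.+1 ++ expr_code e2 tmp.+2 ++
      [:: Write (expr_reg e1 tmp.+1) (expr_reg e2 tmp.+2)]
  | Seq c1 c2 => let p1 := compile c1 o in p1 ++ compile c2 (o + size p1)
  | If e c1 c2 =>
      let p := expr_code e tmp.+1 in
      let o1 := o + size p + 1 in
      let p1 := compile c1 o1 in
      let o2 := o1 + size p1 + 2 in
      let p2 := compile c2 o2 in
      p ++ [:: Jz (expr_reg e tmp.+1) o2] ++ p1 ++ goto (o2 + size p2) ++ p2
  | While e c =>
      let p := expr_code e tmp.+1 in
      let o1 := o + size p + 1 in
      let p1 := compile c o1 in
      p ++ [:: Jz (expr_reg e tmp.+1) (o1 + size p1 + 2)] ++ p1 ++ goto o
  end.

Definition state := ((nat -> nat) * (nat -> nat))%type.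

(** The junk value 0 belongs to the operations that [binop_safe] excludes. *)
Definition binop_val (o : binop) (x y : nat) : nat :=
  match o with
  | OpAdd => x + y
  | OpMul => x * y
  | OpDiv => x %/ y
  | OpMod => x %% y
  | OpLtn => x < y
  | OpEqn => x == y
  | _ => 0
  end.

Fixpoint eval (st : state) (e : expr) : nat :=
  match e with
  | Var x => st.1 x
  | Cst n => n
  | Bin o e1 e2 => binop_val o (eval st e1) (eval st e2)
  | Deref e1 => st.2 (eval st e1)
  end.

Definition binop_safe (M : nat) (o : binop) (x y : nat) : Prop :=
  match o with
  | OpAdd => x + y < M
  | OpMul => x * y < M
  | OpDiv | OpMod => x < M
  | OpLtn | OpEqn => 1 < M
  | _ => False
  end.

(* No overflow, no memory access beyond the [s] cells, and only registers
   below [tmp]: the machine then computes the exact value [eval st e]. *)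
Fixpoint safe (M s : nat) (st : state) (e : expr) : Prop :=
  match e with
  | Var x => x < tmp
  | Cst n => n < M
  | Bin o e1 e2 =>
      [/\ safe M s st e1, safe M s st e2 & binop_safe M o (eval st e1) (eval st e2)]
  | Deref e1 => safe M s st e1 /\ eval st e1 < s
  end.

Fixpoint expr_cost (e : expr) : nat :=
  match e with
  | Var _ => 0
  | Cst _ => 1
  | Bin _ e1 e2 => (expr_cost e1 + expr_cost e2).+1
  | Deref e1 => (expr_cost e1).+1
  end.

(** * Timed semantics and correctness of the compiler *)

Section Semantics.
Variables W s : nat.

(** The number counts the steps of the compiled code exactly. The summands 2 are the two
    instructions of a register move, or of the [goto] that follows a taken first branch or a loop
    body. *)
Inductive exec : cmd -> state -> nat -> state -> Prop :=
  | ExecSkip st : exec Skip st 0 st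
  | ExecAsg x e f m : x < tmp -> safe (2 ^ W) s (f, m) e -> eval (f, m) e < 2 ^ W ->
      exec (Asg x e) (f, m) (expr_cost e + 2) (upd f x (eval (f, m) e), m)
  | ExecSto e1 e2 f m : safe (2 ^ W) s (f, m) e1 -> safe (2 ^ W) s (f, m) e2 ->
      eval (f, m) e1 < s ->
      exec (Sto e1 e2) (f, m) (expr_cost e1 + expr_cost e2 + 1)
        (f, upd m (eval (f, m) e1) (eval (f, m) e2))
  | ExecSeq c1 c2 st t1 st1 t2 st2 :
      exec c1 st t1 st1 -> exec c2 st1 t2 st2 -> exec (Seq c1 c2) st (t1 + t2) st2
  | ExecIf1 e c1 c2 st t st1 : safe (2 ^ W) s st e -> eval st e != 0 ->
      exec c1 st t st1 -> exec (If e c1 c2) st (expr_cost e + 1 + t + 2) st1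
  | ExecIf0 e c1 c2 st t st1 : safe (2 ^ W) s st e -> eval st e = 0 ->
      exec c2 st t st1 -> exec (If e c1 c2) st (expr_cost e + 1 + t) st1
  | ExecWhile0 e c st : safe (2 ^ W) s st e -> eval st e = 0 ->
      exec (While e c) st (expr_cost e + 1) st
  | ExecWhile1 e c st t1 st1 t2 st2 : safe (2 ^ W) s st e -> eval st e != 0 ->
      exec c st t1 st1 -> exec (While e c) st1 t2 st2 ->
      exec (While e c) st (expr_cost e + 1 + t1 + 2 + t2) st2.

Definition run (P : program) (t : nat) (c : config) : option config :=
  iter t (obind (step W s P)) (Some c).

Arguments run : simpl never.

Lemma run_add P t1 t2 c c1 : run P t1 c = Some c1 -> run P (t1 + t2) c = run P t2 c1.
Proof. by rewrite /run addnC iterD => ->. Qed.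

Lemma run1 P c : run P 1 c = step W s P c.
Proof. by []. Qed.

Definition agree (f g : nat -> nat) := forall x, x < tmp -> f x = g x.

Lemma agree_upd_tmp f g x v : tmp <= x -> agree f g -> agree (upd f x v) g.
Proof.
move=> hx fg y hy; rewrite /upd; case: eqP => [e|_]; last exact: fg.
by move: hy hx; rewrite e; lia.
Qed.

Lemma onth_mid (T : Type) (p q r : seq T) o i :
  o = size p -> i < size q -> onth (p ++ q ++ r) (o + i) = onth q i.
Proof.
move=> -> hi; elim: p => [|x p IH] //=; rewrite add0n.
by elim: q i hi => [|y q IH] [|i] //= hi; apply: IH.
Qed.

Definition code_at (P : program) (o : nat) (q : program) :=
  exists p r, P = p ++ q ++ r /\ o = size p.

Lemma code_at_onth P o q i : code_at P o q -> i < size q -> onth P (o + i) = onth q i.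
Proof. by case=> p [r [-> eo]] hi; apply: onth_mid. Qed.

Lemma code_at_catl P o q1 q2 : code_at P o (q1 ++ q2) -> code_at P o q1.
Proof. by case=> p [r [-> eo]]; exists p, (q2 ++ r); rewrite -!catA. Qed.

Lemma code_at_catr P o q1 q2 : code_at P o (q1 ++ q2) -> code_at P (o + size q1) q2.
Proof. by case=> p [r [-> eo]]; exists (p ++ q1), r; rewrite -!catA size_cat eo. Qed.

Lemma code_at_head P o i q : code_at P o (i :: q) -> onth P o = Some i.
Proof. by move=> h; rewrite -[o]addn0 (code_at_onth (i := 0) h). Qed.

Lemma code_at_behead P o i q : code_at P o (i :: q) -> code_at P o.+1 q.
Proof. by move=> h; rewrite -addn1; apply: (@code_at_catr _ _ [:: i]). Qed.

Lemma size_expr_code e d : size (expr_code e d) = expr_cost e.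
Proof.
rewrite /expr_code; elim: e d => [x|n|o e1 IH1 e2 IH2|e IH] d //=.
  case E1: (compile_expr e1 d) => [p1 r1]; case E2: (compile_expr e2 d.+1) => [p2 r2].
  move: (IH1 d) (IH2 d.+1); rewrite E1 E2 /= !size_cat /= => -> ->; lia.
by case E: (compile_expr e d) (IH d) => [p r] /= <-; rewrite size_rcons.
Qed.

Lemma binop_semE o x y :
  binop_safe (2 ^ W) o x y -> binop_sem W o x y = binop_val o x y.
Proof.
rewrite /binop_sem; case: o => //= h; rewrite modn_small //.
- exact: leq_ltn_trans (leq_div _ _) h.
- exact: leq_ltn_trans (leq_mod _ _) h.
- exact: leq_ltn_trans (leq_b1 _) h.
- exact: leq_ltn_trans (leq_b1 _) h.
Qed.

Lemma expr_reg_cases e d : expr_reg e d = d \/ e = Var (expr_reg e d).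
Proof.
rewrite /expr_reg; case: e => [x|n|o e1 e2|e] /=; [by right|by left|left|left].
  by case: (compile_expr e1 d) => ??; case: (compile_expr e2 _).
by case: (compile_expr e d).
Qed.

(** That registers below [d] survive is what the induction needs: the right operand is compiled at
    [d.+1], so it cannot destroy the left result, which lies at or below [d]. *)
Lemma compile_expr_correct P e d o f g m : tmp < d ->
  agree g f -> safe (2 ^ W) s (f, m) e -> code_at P o (expr_code e d) ->
  exists g', [/\ run P (expr_cost e) (Config o g m) = Some (Config (o + expr_cost e) g' m),
    forall x, x < d -> g' x = g x, g' (expr_reg e d) = eval (f, m) e & expr_reg e d <= d].
Proof.
elim: e d o g => [x|n|op e1 IH1 e2 IH2|e IH] d o g hd ag.
- move=> /= hx _; exists g; split=> //; first by rewrite addn0.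
    exact: ag.
  rewrite /expr_reg /=; lia.
- move=> /= hn /code_at_head ho; exists (upd g d n); split=> //.
  + by rewrite run1 /step ho modn_small // addn1.
  + by move=> x hx; rewrite /upd; case: eqP hx => // ->; rewrite ltnn.
  + by rewrite /upd /expr_reg /= eqxx.
- rewrite /expr_code /expr_reg /=.
  move: (IH1 d) (IH2 d.+1) (size_expr_code e1 d) (size_expr_code e2 d.+1).
  rewrite /expr_code /expr_reg.
  case: (compile_expr e1 d) => [p1 r1]; case: (compile_expr e2 d.+1) => [p2 r2] /=.
  move=> {}IH1 {}IH2 z1 z2 [s1 s2 sb] hc.
  have [g1 [run1' low1 val1 le1]] := IH1 _ _ hd ag s1 (code_at_catl hc).
  have ag1 : agree g1 f by move=> x hx; rewrite low1 ?ag //; lia.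
  have hc2 := code_at_catr hc; rewrite z1 in hc2.
  have [g2 [run2 low2 val2 le2]] := IH2 _ _ (ltnW hd) ag1 s2 (code_at_catl hc2).
  have := code_at_catr hc2; rewrite z2 => /code_at_head h3.
  exists (upd g2 d (binop_val op (eval (f, m) e1) (eval (f, m) e2))); split=> //.
  + rewrite -addn1 (run_add _ (c1 := Config (o + expr_cost e1 + expr_cost e2) g2 m)).
      rewrite run1 /step h3 val2 low2 ?val1 ?binop_semE //.
      by congr (Some (Config _ _ _)); lia.
    by rewrite (run_add _ run1').
  + move=> x hx; rewrite /upd; case: eqP => [e|_]; first by move: hx; rewrite e ltnn.
    rewrite low2 ?low1 //; lia.
  + by rewrite /upd eqxx.
- rewrite /expr_code /expr_reg /=.
  move: (IH d) (size_expr_code e d); rewrite /expr_code /expr_reg.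
  case: (compile_expr e d) => [p r] /= {}IH z [se lt].
  rewrite -cats1 => hc.
  have [g1 [run1' low1 val1 le1]] := IH _ _ hd ag se (code_at_catl hc).
  have := code_at_catr hc; rewrite z => /code_at_head h3.
  exists (upd g1 d (m (eval (f, m) e))); split=> //.
  + rewrite -addn1 (run_add _ run1') run1 /step h3 val1 lt.
    by congr (Some (Config _ _ _)); lia.
  + move=> x hx; rewrite /upd; case: eqP => [e'|_]; first by move: hx; rewrite e' ltnn.
    by rewrite low1.
  + by rewrite /upd eqxx.
Qed.

Lemma run_jz P o x q g m : onth P o = Some (Jz x q) ->
  run P 1 (Config o g m) = Some (Config (if g x == 0 then q else o.+1) g m).
Proof. by move=> h; rewrite run1 /step h. Qed.

Lemma run_goto P o q g m : code_at P o (goto q) ->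
  run P 2 (Config o g m) = Some (Config q (upd g tmp 0) m).
Proof.
move=> h; have h1 := code_at_head h; have h2 := code_at_head (code_at_behead h).
rewrite (run_add 1 (t1 := 1) (c1 := Config o.+1 (upd g tmp 0) m)).
  by rewrite (run_jz _ _ h2).
by rewrite run1 /step h1 mod0n.
Qed.

Definition sim P (c : cmd) (st : state) t (st' : state) :=
  forall o g, agree g st.1 -> code_at P o (compile c o) ->
  exists g', run P t (Config o g st.2) = Some (Config (o + size (compile c o)) g' st'.2)
    /\ agree g' st'.1.

Lemma compile_correct P c st t st' : exec c st t st' -> sim P c st t st'.
Proof.
have ltt : tmp < tmp.+1 by [].
elim=> {c st t st'}.
- by move=> st o g ag _; exists g; rewrite addn0.
- move=> x e f m hx hs hv o g ag /= hc.
  have [g1 [r1 low1 val1 le1]] := compile_expr_correct ltt ag hs (code_at_catl hc).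
  have := code_at_catr hc; rewrite size_expr_code => hc2.
  have h2 := code_at_head hc2; have h3 := code_at_head (code_at_behead hc2).
  set r := expr_reg e tmp.+1 in val1 h3 le1.
  (* Clearing [tmp] must not destroy the value: its register is [tmp.+1] or a program variable,
     never [tmp]. *)
  have hr : upd g1 tmp 0 r = eval (f, m) e.
    rewrite /upd; case: eqP => [er|//].
    have [e1|e1] := expr_reg_cases e tmp.+1; first by move: er; rewrite /r e1.
    by move: hs; rewrite e1 -/r er.
  exists (upd (upd g1 tmp 0) x (eval (f, m) e)); split.
    rewrite (run_add _ r1) (run_add 1 (t1 := 1) (c1 := Config (o + expr_cost e).+1 (upd g1 tmp 0) m)).
      rewrite run1 /step h3 hr (_ : upd g1 tmp 0 tmp = 0) // binop_semE /= ?addn0 //.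
      by rewrite size_cat size_expr_code /=; congr (Some (Config _ _ _)); lia.
    by rewrite run1 /step h2 mod0n.
  move=> y hy; rewrite /upd /=; case: eqP => // _; case: eqP => [e0|_].
    by move: hy; rewrite e0.
  by rewrite low1 ?ag //; lia.
- move=> e1 e2 f m s1 s2 lt o g ag /= hc.
  have [g1 [r1 low1 val1 le1]] := compile_expr_correct ltt ag s1 (code_at_catl hc).
  have := code_at_catr hc; rewrite size_expr_code => hc2.
  have ag1 : agree g1 f by move=> x hx; rewrite low1 ?ag //; lia.
  have [g2 [r2 low2 val2 le2]] := compile_expr_correct (ltnW ltt : tmp < tmp.+2) ag1 s2 (code_at_catl hc2).
  have := code_at_catr hc2; rewrite size_expr_code => /code_at_head h3.
  exists g2; split; last by move=> x hx; rewrite low2 ?ag1 //; lia.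
  rewrite -addnA (run_add _ r1) (run_add _ r2) run1 /step h3 val2 low2 ?val1 ?lt //.
  by rewrite !size_cat !size_expr_code /=; congr (Some (Config _ _ _)); lia.
- move=> c1 c2 st t1 st1 t2 st2 _ IH1 _ IH2 o g ag /= hc.
  have [g1 [r1 ag1]] := IH1 _ _ ag (code_at_catl hc).
  have [g2 [r2 ag2]] := IH2 _ _ ag1 (code_at_catr hc).
  by exists g2; rewrite (run_add _ r1) r2 size_cat addnA.
- move=> e c1 c2 [f m] t [f1 m1] hs hv _ IH o g ag /=.
  set o1 := _ + 1; set q1 := compile c1 o1; set o2 := _ + 2; set q2 := compile c2 o2 => hc.
  have [g1 [r1 low1 val1 le1]] := compile_expr_correct ltt ag hs (code_at_catl hc).
  have := code_at_catr hc; rewrite size_expr_code => hc2.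
  have h2 := code_at_head hc2; have := code_at_behead hc2.
  rewrite -addn1 /= -{1}(size_expr_code e tmp.+1) -/o1 => hc3.
  have ag1 : agree g1 f by move=> x hx; rewrite low1 ?ag //; lia.
  have [g2 [r2 ag2]] := IH _ _ ag1 (code_at_catl hc3).
  have hc4 := code_at_catr hc3.
  exists (upd g2 tmp 0); split; last exact: agree_upd_tmp.
  rewrite -!addnA (run_add _ r1) (run_add _ (c1 := Config o1 g1 m)).
    rewrite (run_add _ r2) (run_goto _ _ (code_at_catl (q1 := goto (o2 + size q2)) hc4)) /= !size_cat /= size_cat /=.
    congr (Some (Config _ _ _)); rewrite -/q2; lia.
  rewrite (run_jz _ _ h2) val1 (negbTE hv) /o1 size_expr_code.
  by congr (Some (Config _ _ _)); lia.
- move=> e c1 c2 [f m] t [f1 m1] hs hv _ IH o g ag /=.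
  set o1 := _ + 1; set q1 := compile c1 o1; set o2 := _ + 2; set q2 := compile c2 o2 => hc.
  have [g1 [r1 low1 val1 le1]] := compile_expr_correct ltt ag hs (code_at_catl hc).
  have := code_at_catr hc; rewrite size_expr_code => hc2.
  have h2 := code_at_head hc2; have := code_at_behead hc2.
  rewrite -addn1 /= -{1}(size_expr_code e tmp.+1) -/o1 => hc3.
  have ag1 : agree g1 f by move=> x hx; rewrite low1 ?ag //; lia.
  have := code_at_catr (q1 := goto (o2 + size q2)) (code_at_catr hc3).
  have -> : o1 + size q1 + size (goto (o2 + size q2)) = o2 by rewrite /= /o2; lia.
  move=> hc4; have [g2 [r2 ag2]] := IH _ _ ag1 hc4.
  exists g2; split=> //.
  rewrite -!addnA (run_add _ r1) (run_add _ (c1 := Config o2 g1 m)).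
    rewrite r2 !size_cat /= size_cat /=.
    congr (Some (Config _ _ _)); rewrite -/q2; lia.
  by rewrite (run_jz _ _ h2) val1 hv.
- move=> e c [f m] hs hv o g ag /=.
  set o1 := _ + 1; set q1 := compile c o1 => hc.
  have [g1 [r1 low1 val1 le1]] := compile_expr_correct ltt ag hs (code_at_catl hc).
  have := code_at_catr hc; rewrite size_expr_code => /code_at_head h2.
  exists g1; split; last by move=> x hx; rewrite low1 ?ag //; lia.
  rewrite (run_add _ r1) (run_jz _ _ h2) val1 hv /= !size_cat /= size_cat /=.
  by congr (Some (Config _ _ _)); rewrite /o1 size_expr_code; lia.
- move=> e c [f m] t1 [f1 m1] t2 st2 hs hv _ IH1 _ IH2 o g ag hc0; move: (hc0) => /=.
  set o1 := _ + 1; set q1 := compile c o1 => hc.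
  have [g1 [r1 low1 val1 le1]] := compile_expr_correct ltt ag hs (code_at_catl hc).
  have := code_at_catr hc; rewrite size_expr_code => hc2.
  have h2 := code_at_head hc2; have := code_at_behead hc2.
  rewrite -addn1 /= -{1}(size_expr_code e tmp.+1) -/o1 => hc3.
  have ag1 : agree g1 f by move=> x hx; rewrite low1 ?ag //; lia.
  have [g2 [r2 ag2]] := IH1 _ _ ag1 (code_at_catl hc3).
  have [g3 [r3 ag3]] := IH2 o _ (agree_upd_tmp 0 (leqnn _) ag2) hc0.
  exists g3; split=> //.
  rewrite -!addnA (run_add _ r1) (run_add _ (c1 := Config o1 g1 m)).
    rewrite (run_add _ r2) (run_add _ (run_goto _ _ (code_at_catr hc3 : code_at _ _ (goto o)))) r3.
    by rewrite !addnA.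
  rewrite (run_jz _ _ h2) val1 (negbTE hv) /o1 size_expr_code.
  by congr (Some (Config _ _ _)); lia.
Qed.

Lemma exec_computes c input t st : size input <= s <= 2 ^ W ->
  exec c (fun=> 0, nth 0 input) t st ->
  exists cf, computes W s t (compile c 0) input cf /\ memory cf = st.2.
Proof.
move=> hs hx.
have [||g [r _]] := compile_correct (P := compile c 0) hx (o := 0) (g := fun=> 0).
- by [].
- by exists [::], [::]; rewrite cats0.
by exists (Config (0 + size (compile c 0)) g st.2); split=> //; split=> //=; rewrite add0n.
Qed.

(** Total correctness, as a terminating execution is exhibited. [T] is the time already spent, so
    that postconditions bound the time of the whole run and compose without bookkeeping. *)
Definition wp (c : cmd) (Q : nat -> state -> Prop) (T : nat) (st : state) : Prop :=
  exists t st', exec c st t st' /\ Q (T + t) st'.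

Lemma wp_skip (Q : nat -> state -> Prop) T st : Q T st -> wp Skip Q T st.
Proof. by exists 0, st; split; [constructor|rewrite addn0]. Qed.

Lemma wp_asg x e (Q : nat -> state -> Prop) T f m :
  x < tmp -> safe (2 ^ W) s (f, m) e -> eval (f, m) e < 2 ^ W ->
  Q (T + (expr_cost e + 2)) (upd f x (eval (f, m) e), m) -> wp (Asg x e) Q T (f, m).
Proof. by move=> h1 h2 h3 h4; do 2!eexists; split; [exact: ExecAsg|]. Qed.

Lemma wp_sto e1 e2 (Q : nat -> state -> Prop) T f m :
  safe (2 ^ W) s (f, m) e1 -> safe (2 ^ W) s (f, m) e2 -> eval (f, m) e1 < s ->
  Q (T + (expr_cost e1 + expr_cost e2 + 1)) (f, upd m (eval (f, m) e1) (eval (f, m) e2)) ->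
  wp (Sto e1 e2) Q T (f, m).
Proof. by move=> h1 h2 h3 h4; do 2!eexists; split; [exact: ExecSto|]. Qed.

Lemma wp_seq c1 c2 (Q : nat -> state -> Prop) T st :
  wp c1 (wp c2 Q) T st -> wp (Seq c1 c2) Q T st.
Proof.
move=> [t1 [st1 [x1 [t2 [st2 [x2 q]]]]]]; exists (t1 + t2), st2.
by rewrite addnA; split=> //; apply: ExecSeq x2.
Qed.

Lemma wp_if e c1 c2 (Q : nat -> state -> Prop) T st : safe (2 ^ W) s st e ->
  (eval st e != 0 -> wp c1 (fun T => Q (T + 2)) (T + (expr_cost e + 1)) st) ->
  (eval st e = 0 -> wp c2 Q (T + (expr_cost e + 1)) st) -> wp (If e c1 c2) Q T st.
Proof.
move=> hs h1 h2; have [e0|e0] := eqVneq (eval st e) 0.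
  have [t [st' [x q]]] := h2 e0; do 2!eexists; split; first exact: ExecIf0 x.
  by rewrite addnA.
have [t [st' [x q]]] := h1 e0; do 2!eexists; split; first exact: ExecIf1 x.
by rewrite !addnA in q *.
Qed.

(** The number [N] of rounds is given beforehand. It serves as the variant, and the index of the
    invariant lets the elapsed time be bounded round by round. *)
Lemma wp_while (N : nat) (I : nat -> nat -> state -> Prop) e c Q T st :
  I 0 T st ->
  (forall i T st, i < N -> I i T st ->
     [/\ safe (2 ^ W) s st e, eval st e != 0 &
         wp c (fun T => I i.+1 (T + 2)) (T + (expr_cost e + 1)) st]) ->
  (forall T st, I N T st ->
     [/\ safe (2 ^ W) s st e, eval st e = 0 & Q (T + (expr_cost e + 1)) st]) ->
  wp (While e c) Q T st.
Proof.
move=> h0 hS hN.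
suff H d i T' st' : i + d = N -> I i T' st' -> wp (While e c) Q T' st'.
  exact: (H N 0).
elim: d i T' st' => [|d IH] i T' st' ed hi.
  rewrite -ed addn0 in hN; have [se ev q] := hN _ _ hi.
  by do 2!eexists; split; [exact: ExecWhile0|].
have [|se ev [t1 [st1 [x1 q1]]]] := hS i T' st' _ hi; first lia.
have [|t2 [st2 [x2 q2]]] := IH i.+1 _ _ _ q1; first lia.
do 2!eexists; split; first exact: ExecWhile1 x1 x2.
by rewrite !addnA in q2 *.
Qed.

End Semantics.

(** * Primes *)

(** By Pascal's rule the coefficient at least doubles: it is the sum of the two equal middle entries
    of row 2m + 1, each at least the central entry of row 2m. *)
Lemma leq_exp2_bin_central m : 2 ^ m <= 'C(m.*2, m).
Proof.
elim: m => [|m IH] //; rewrite doubleS expnS.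
have e1 := mul_bin_diag m.*2.+1 m.
have e2 := mul_bin_diag m.*2 m.
have e3 := bin_sub (leq_addr m m); rewrite addnn in e3.
have e4 : 'C(m.*2.+1, m) = 'C(m.*2.+1, m.+1).
  by rewrite -[LHS]bin_sub; [congr binomial; lia|lia].
have := binS m.*2.+1 m; rewrite e4 => ->.
by have := binS m.*2 m; lia.
Qed.

(** By Legendre's formula the exponent of p is the sum over k of floor(2m / p^k) - 2 floor(m / p^k).
    Each term is at most 1 and vanishes once p^k > 2m, so the exponent is at most the largest t with
    p^t <= 2m. *)
Lemma logn_bin_central p m : prime p -> 0 < m -> p ^ logn p 'C(m.*2, m) <= m.*2.
Proof.
move=> pp m0; have p1 := prime_gt1 pp.
have hm : m <= m.*2 by lia.
have := bin_fact hm; rewrite (_ : m.*2 - m = m); last lia.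
move/(congr1 (logn p)); rewrite !lognM ?muln_gt0 ?fact_gt0 ?bin_gt0 // !logn_fact //.
set N := m.*2; set t := trunc_log p N.
have ht : N < p ^ t.+1 by apply: trunc_log_ltn.
have hpt : p ^ t <= N by apply: trunc_logP; rewrite ?/N; lia.
(* Legendre's sums for (2m)! and m! run up to 2m and m; cutting both at t requires t <= m. *)
have tm : t <= m.
  have : 2 ^ t <= N.
    by apply: leq_trans hpt; case: (posnP t) => [->|t0] //; rewrite leq_exp2r.
  by case: (t) => [|t'] //; rewrite expnS; have := ltn_expl t' (ltnSn 1); rewrite /N; lia.
have split F M : t <= M -> (forall k, t < k -> F k = 0) ->
    \sum_(1 <= k < M.+1) F k = \sum_(1 <= k < t.+1) F k.
  move=> tM hF; rewrite (big_cat_nat _ (n := t.+1)) //=.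
  rewrite [X in _ + X]big_nat_cond [X in _ + X]big1 ?addn0 // => k.
  by case/andP=> /andP[hk _] _; apply: hF.
have hexp x k : x <= N -> t < k -> x %/ p ^ k = 0.
  move=> hx hk; rewrite divn_small //; apply: leq_ltn_trans hx _.
  by apply: leq_trans ht _; rewrite leq_exp2l.
have tN : t <= N by rewrite /N; lia.
have mN : m <= N by rewrite /N; lia.
rewrite (split _ _ tN (fun k => @hexp N k (leqnn N))) (split _ _ tm (fun k => @hexp m k mN)).
move=> e; have : logn p 'C(N, m) <= t.
  have : \sum_(1 <= k < t.+1) N %/ p ^ k <= \sum_(1 <= k < t.+1) (m %/ p ^ k + m %/ p ^ k + 1).
    apply: leq_sum => k _; have p0 : 0 < p ^ k by rewrite expn_gt0 prime_gt0.
    by rewrite /N -addnn divnD //; lia.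
  by rewrite !big_split /= sum_nat_const_nat; lia.
by move=> le; apply: leq_trans hpt; rewrite leq_exp2l.
Qed.

(** Every prime power in the factorisation is at most 2m; in particular so is every prime that
    occurs. *)
Lemma bin_central_le m : 0 < m -> 'C(m.*2, m) <= m.*2 ^ count prime (iota 0 m.*2.+1).
Proof.
move=> m0; have c0 : 0 < 'C(m.*2, m) by rewrite bin_gt0; lia.
rewrite {1}(prod_prime_decomp c0) prime_decompE big_map /=.
have hle p : p \in primes 'C(m.*2, m) -> p ^ logn p 'C(m.*2, m) <= m.*2.
  by rewrite mem_primes => /and3P[pp _ _]; apply: logn_bin_central.
apply: (@leq_trans (m.*2 ^ size (primes 'C(m.*2, m)))).
  elim: (primes _) hle => [|p ps IH] hle; first by rewrite big_nil.
  rewrite big_cons expnS leq_mul ?hle ?mem_head // IH // => q hq.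
  by apply: hle; rewrite inE hq orbT.
apply: leq_pexp2l; first lia.
rewrite -size_filter uniq_leq_size ?primes_uniq // => p hp.
have := hle _ hp; move: hp; rewrite mem_primes => /and3P[pp _ pd] hp.
rewrite mem_filter pp mem_iota /=; suff : p <= m.*2 by lia.
apply: leq_trans hp.
have l0 : 0 < logn p 'C(m.*2, m) by rewrite logn_gt0 mem_primes pp c0.
by rewrite -[X in X <= _]expn1; exact: leq_pexp2l (prime_gt0 pp) l0.
Qed.

(** For m = h w, the hypothesis 2m <= 2^h turns the bound 2^m <= (2m)^c, with c the number of primes
    up to 2m, into h w <= h c. *)
Lemma leq_count_prime h w : 0 < h -> 0 < w -> (h * w).*2 <= 2 ^ h ->
  w <= count prime (iota 0 (h * w).*2.+1).
Proof.
move=> h0 w0 le; have hw : 0 < h * w by rewrite muln_gt0 h0.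
have := leq_trans (leq_exp2_bin_central (h * w)) (bin_central_le hw).
set c := count _ _ => le2.
have : 2 ^ (h * w) <= 2 ^ (h * c).
  apply: leq_trans le2 _; rewrite expnM; case: (c) => [|c']; first by [].
  by rewrite leq_exp2r.
by rewrite leq_exp2l // leq_pmul2l.
Qed.

Lemma prod_primes_dvdn (ps : seq nat) d : uniq ps -> all prime ps ->
  (forall p, p \in ps -> p %| d) -> \prod_(p <- ps) p %| d.
Proof.
elim: ps => [|p ps IH] /=; first by rewrite big_nil dvd1n.
case/andP=> np us /andP[pp ap] hd; rewrite big_cons Gauss_dvd.
  rewrite hd ?mem_head //= IH // => q hq; apply: hd; by rewrite inE hq orbT.
rewrite coprime_sym big_seq; apply: (big_ind (fun x => coprime x p)).
- exact: coprime1n.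
- by move=> x y hx hy; rewrite coprimeMl hx.
move=> q hq; have pq := allP ap _ hq; rewrite coprime_sym prime_coprime // dvdn_prime2 //.
by apply: contra np => /eqP ->.
Qed.

Lemma count_eqmod_primes (ps : seq nat) u v L : uniq ps -> all prime ps ->
  u != v -> u < 2 ^ L -> v < 2 ^ L -> count (fun p => u %% p == v %% p) ps <= L.
Proof.
wlog: u v / v < u.
  move=> H us ap; rewrite neq_ltn => /orP[lt|lt] hu hv; last by apply: H => //; rewrite neq_ltn lt orbT.
  rewrite (eq_count (a2 := fun p => v %% p == u %% p)); last by move=> p; rewrite eq_sym.
  by apply: H => //; rewrite neq_ltn lt orbT.
move=> lt us ap _ hu _; rewrite -size_filter; set qs := filter _ _.
have hd p : p \in qs -> p %| u - v by rewrite mem_filter -eqn_mod_dvd ?(ltnW lt) // => /andP[].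
have aq : all prime qs by rewrite all_filter; apply: sub_all ap => p /= ->; rewrite implybT.
have /dvdn_leq := prod_primes_dvdn (filter_uniq _ us) aq hd.
rewrite subn_gt0 lt => /(_ isT) le.
rewrite -(leq_exp2l (m := 2)) //; apply: (@leq_trans (\prod_(p <- qs) p)); last by apply: leq_trans le _; apply: leq_trans (leq_subr _ _) (ltnW hu).
elim: (qs) aq => [|q rs IH] /=; first by rewrite big_nil.
by case/andP=> pq ar; rewrite big_cons expnS leq_mul ?prime_gt1 // IH.
Qed.

(** * The greedy assignment to buckets *)

(* Nodes of a complete binary tree of depth [d] are numbered as in a heap: the
   root is 1, the children of x are 2x and 2x + 1, the leaves are the numbers
   in [2 ^ d, 2 ^ d.+1). *)
Definition path_up (b t : nat) : seq nat := mkseq (fun j => b %/ 2 ^ j) t.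

Definition tree_cost (T : nat -> nat -> nat) (s : seq nat) (x : nat) : nat :=
  \sum_(i <- s) T i x.

Fixpoint descend (T : nat -> nat -> nat) (s : seq nat) (t : nat) : nat :=
  if t is t'.+1 then
    let x := descend T s t' in
    2 * x + (tree_cost T s (2 * x + 1) < tree_cost T s (2 * x))
  else 1.

(** One more element in leaf b doubles 2^load, so the charge T i b = 2^load - 1 grows by T i b + 1;
    all ancestors of b grow by the same amount. *)
Definition bump (d : nat) (T : nat -> nat -> nat) (s : seq nat) (b : nat) :=
  fun i x => T i x + ((i \in s) && (x \in path_up b d.+1)) * (T i b).+1.

Fixpoint trees (d : nat) (inc : nat -> seq nat) (u : nat) : nat -> nat -> nat :=
  if u is u'.+1 then
    let T := trees d inc u' in bump d T (inc u') (descend T (inc u') d)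
  else fun _ _ => 0.

(** Buckets keep their leaf numbers, which start at 2^d; hence the factor 2 * 2^d in the length. *)
Definition bucket d inc u := descend (trees d inc u) (inc u) d.

Definition load d inc u i b :=
  count (fun v => (i \in inc v) && (bucket d inc v == b)) (iota 0 u).

Lemma descend_bounds T s t : 2 ^ t <= descend T s t < 2 ^ t.+1.
Proof.
elim: t => //= t; set x := descend T s t; rewrite !expnS => /andP[h1 h2].
by case: (_ < _); lia.
Qed.

Lemma bucket_bounds d inc u : 2 ^ d <= bucket d inc u < 2 ^ d.+1.
Proof. exact: descend_bounds. Qed.

Lemma divn_exp2S b t : b %/ 2 ^ t.+1 = (b %/ 2 ^ t) %/ 2.
Proof. by rewrite expnS mulnC divnMA. Qed.

Lemma path_up_mem b t x : reflect (exists2 j, j < t & x = b %/ 2 ^ j) (x \in path_up b t).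
Proof.
apply: (iffP mapP) => [[j]|[j lt ->]]; last by exists j; rewrite ?mem_iota.
by rewrite mem_iota => lt ->; exists j.
Qed.

Lemma div_exp2_bounds d b j : 2 ^ d <= b < 2 ^ d.+1 -> j <= d ->
  2 ^ (d - j) <= b %/ 2 ^ j < 2 ^ (d - j).+1.
Proof.
move=> /andP[h1 h2] le; have p0 : 0 < 2 ^ j by rewrite expn_gt0.
by rewrite leq_divRL // ltn_divLR // -!expnD subnK // addSn subnK // h1.
Qed.

Lemma div_exp2_inj d b j l : 2 ^ d <= b < 2 ^ d.+1 -> j <= d -> l <= d ->
  b %/ 2 ^ j = b %/ 2 ^ l -> j = l.
Proof.
move=> hb hj hl e; have /andP[h1 h2] := div_exp2_bounds hb hj.
have /andP[h3 h4] := div_exp2_bounds hb hl; rewrite e in h1 h2.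
have := leq_ltn_trans h1 h4; have := leq_ltn_trans h3 h2.
by rewrite !ltn_exp2l //; lia.
Qed.

(** In this numerical form it shows that [bump] keeps every inner node the sum of its children: an
    increment at x comes from exactly one child. *)
Lemma path_up_children d b x : 2 ^ d <= b < 2 ^ d.+1 -> 0 < x < 2 ^ d ->
  (x \in path_up b d.+1) = (2 * x \in path_up b d.+1) + (2 * x + 1 \in path_up b d.+1) :> nat.
Proof.
move=> hb /andP[x0 xd].
have up y : y %/ 2 = x -> y \in path_up b d.+1 -> x \in path_up b d.+1.
  move=> yx /path_up_mem[j lt e]; apply/path_up_mem; exists j.+1; last first.
    by rewrite divn_exp2S -e.
  rewrite ltnS ltn_neqAle -ltnS lt andbT; apply/eqP => jd.
  have := div_exp2_bounds hb (leqnn d); rewrite subnn -jd -e; move: yx x0; lia.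
have both : ~~ ((2 * x \in path_up b d.+1) && (2 * x + 1 \in path_up b d.+1)).
  apply/negP => /andP[/path_up_mem[j lj ej] /path_up_mem[l ll el]].
  rewrite ltnS in lj ll.
  have /andP[a1 a2] := div_exp2_bounds hb lj; have /andP[a3 a4] := div_exp2_bounds hb ll.
  rewrite -ej in a1 a2; rewrite -el in a3 a4.
  (* Both children have the same depth, and a path has only one node of each depth. *)
  have jl : j = l.
    have : 2 ^ (d - j) < 2 ^ (d - l).+1 by lia.
    have : 2 ^ (d - l) <= 2 * x.
      case: (d - l) a3 => [|y]; first by lia.
      by rewrite expnS; lia.
    move=> h5 h6; have := leq_ltn_trans h5 a2; move: h6.
    by rewrite !ltn_exp2l //; lia.
  by move: ej el; rewrite jl => <-; lia.
have down : x \in path_up b d.+1 -> (2 * x \in path_up b d.+1) || (2 * x + 1 \in path_up b d.+1).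
  move=> /path_up_mem[[|j] lt e].
    by move: hb xd; rewrite e divn1 => /andP[h1 _] h2; lia.
  have hy : b %/ 2 ^ j \in path_up b d.+1 by apply/path_up_mem; exists j => //; lia.
  move: e hy; rewrite divn_exp2S; set y := b %/ 2 ^ j => e hy.
  have [->|->] : 2 * x = y \/ 2 * x + 1 = y by lia.
    by rewrite hy.
  by rewrite hy orbT.
have u1 := up (2 * x); have u2 := up (2 * x + 1).
move: both down u1 u2; case: (2 * x \in _); case: (2 * x + 1 \in _); case: (x \in _) => //=.
- by move=> _ _ /(_ _ isT); rewrite -{1}[x]/x => H _; have := H ltac:(lia).
- by move=> _ _ _ H; have := H ltac:(lia) isT.
- by move=> _ /(_ isT).
Qed.

Lemma path_up_leaf d b x : 2 ^ d <= b < 2 ^ d.+1 -> 2 ^ d <= x ->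
  (x \in path_up b d.+1) = (x == b).
Proof.
move=> hb hx; apply/path_up_mem/eqP => [[j lj e]|->]; last by exists 0; rewrite ?divn1.
have /andP[_ h] := div_exp2_bounds hb (lj : j <= d); move: h hx; rewrite -e.
case: j lj e => [|j] lj e h hx; first by rewrite e divn1.
suff : 2 ^ (d - j.+1).+1 <= 2 ^ d by lia.
by rewrite leq_exp2l //; lia.
Qed.

Lemma path_up_root d b : 2 ^ d <= b < 2 ^ d.+1 -> 1 \in path_up b d.+1.
Proof.
move=> hb; apply/path_up_mem; exists d => //.
by have := div_exp2_bounds hb (leqnn d); rewrite subnn; lia.
Qed.

Lemma count_iotaS (a : pred nat) u : count a (iota 0 u.+1) = count a (iota 0 u) + a u.
Proof. by rewrite -addn1 iotaD count_cat /= addn0 add0n. Qed.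

Lemma sum_seq_const (s : seq nat) c : \sum_(i <- s) c = size s * c.
Proof. by rewrite big_const_seq count_predT iter_addn_0 mulnC. Qed.

(** * Potential function analysis of the greedy assignment *)

Section Greedy.
Variables (d z k N : nat) (inc : nat -> seq nat).
Hypothesis inc_uniq : forall u, uniq (inc u).
Hypothesis inc_lt : forall u i, i \in inc u -> i < z.
Hypothesis inc_size : forall i, count (fun u => i \in inc u) (iota 0 N) <= k.
Hypothesis k_small : 2 * k <= 2 ^ d.

Let Tr := trees d inc.
Let F := bucket d inc.

Lemma trees_node u i x : 0 < x < 2 ^ d -> Tr u i x = Tr u i (2 * x) + Tr u i (2 * x + 1).
Proof.
clear inc_uniq inc_lt inc_size k_small.
move=> hx; elim: u => [|u IH] //; rewrite /Tr /= -/Tr /bump.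
rewrite IH -!mulnb (path_up_children (descend_bounds _ _ _) hx) mulnDr mulnDl; lia.
Qed.

Lemma trees_leaf u i b : 2 ^ d <= b < 2 ^ d.+1 -> (Tr u i b).+1 = 2 ^ load d inc u i b.
Proof.
clear inc_uniq inc_lt inc_size k_small.
move=> hb; elim: u => [|u IH] //; rewrite /Tr /= -/Tr /bump.
have /andP[hb1 hb2] := hb.
rewrite (path_up_leaf (bucket_bounds d inc u) hb1) /load count_iotaS eq_sym.
rewrite -/(load d inc u i b) expnD -IH -/(F u).
rewrite -[descend _ _ _]/(F u); case: (i \in _) => /=; last by lia.
by case: eqP => [->|_] /=; rewrite ?(expn1 2) ?(expn0 2); lia.
Qed.

(** Charges are non-negative and add up along the tree, so a node never exceeds its parent. *)
Lemma trees_le_root u i x : 0 < x < 2 ^ d.+1 -> Tr u i x <= Tr u i 1.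
Proof.
clear inc_uniq inc_lt inc_size k_small.
elim/ltn_ind: x => x IH hx; have [x1|x1] := leqP x 1; first by rewrite (_ : x = 1) //; lia.
rewrite expnS in hx IH.
have [y ey] : exists y, x = 2 * y \/ x = 2 * y + 1 by exists (x %/ 2); lia.
have node := @trees_node u i y ltac:(lia).
have le := IH y ltac:(lia) ltac:(lia).
by case: ey => ->; lia.
Qed.

Lemma trees_mono u v i x : u <= v -> Tr u i x <= Tr v i x.
Proof.
clear inc_uniq inc_lt inc_size k_small.
elim: v => [|v IH]; first by rewrite leqn0 => /eqP->.
rewrite leq_eqVlt => /predU1P[->//|/IH] /leq_trans; apply.
by rewrite /Tr /= /bump leq_addr.
Qed.

Lemma descend_cost u t : t <= d ->
  2 ^ t * tree_cost (Tr u) (inc u) (descend (Tr u) (inc u) t) <= tree_cost (Tr u) (inc u) 1.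
Proof.
clear inc_uniq inc_lt inc_size k_small.
elim: t => [|t IH] td; first by rewrite mul1n.
apply: leq_trans (IH (ltnW td)) => /=.
have := descend_bounds (Tr u) (inc u) t; set x := descend _ _ t => /andP[x1 x2].
have xd : x < 2 ^ d by apply: leq_trans x2 _; rewrite leq_exp2l.
have x0 : 0 < x by apply: leq_trans x1; rewrite expn_gt0.
have e : tree_cost (Tr u) (inc u) x =
    tree_cost (Tr u) (inc u) (2 * x) + tree_cost (Tr u) (inc u) (2 * x + 1).
  by rewrite -big_split; apply: eq_bigr => i _; apply: trees_node; rewrite x0.
rewrite e expnS -mulnA mulnCA leq_pmul2l ?expn_gt0 //.
by case: ltnP => le /=; rewrite ?addn0; lia.
Qed.

Lemma sum_inc u (G : nat -> nat) :
  \sum_(i <- inc u) G i = \sum_(0 <= i < z) (i \in inc u) * G i.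
Proof.
transitivity (\sum_(0 <= i < z | i \in inc u) G i).
  rewrite -[RHS]big_filter; apply: perm_big; apply: uniq_perm => //.
    by rewrite filter_uniq // iota_uniq.
  move=> i; rewrite mem_filter mem_iota /= subn0.
  by case: (boolP (i \in inc u)) => // /inc_lt ->.
by rewrite big_mkcond /=; apply: eq_bigr => i _; case: (_ \in _); rewrite ?mul1n ?mul0n.
Qed.

(** The new element adds T i b + 1 to the root of each set containing it. After multiplication by
    2^d, the terms T i b total at most the sum of those roots, by [descend_cost]. *)
Lemma sum_roots_step u : 2 ^ d * \sum_(0 <= i < z) Tr u.+1 i 1 <=
  2 ^ d * \sum_(0 <= i < z) Tr u i 1 + \sum_(0 <= i < z) (i \in inc u) * (Tr u i 1 + 2 ^ d).
Proof.
rewrite {1}/Tr /= /bump -/Tr big_split /= mulnDr leq_add2l.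
under eq_bigr => i _ do rewrite (path_up_root (bucket_bounds d inc u)) andbT.
rewrite -!sum_inc big_split /= sum_seq_const.
under eq_bigr => i _ do rewrite -addn1.
rewrite big_split /= sum_seq_const muln1 mulnDr [X in _ + X]mulnC leq_add2r.
exact: descend_cost (leqnn d).
Qed.

(** The steps are summed with each root replaced by its final value, which is larger because trees
    only grow. Set i then pays the same amount once for each of its elements. *)
Lemma sum_roots_le u : u <= N -> 2 ^ d * \sum_(0 <= i < z) Tr u i 1 <=
  \sum_(0 <= i < z) count (fun v => i \in inc v) (iota 0 u) * (Tr N i 1 + 2 ^ d).
Proof.
elim: u => [|u IH] uN; first by rewrite big1 ?muln0.
apply: leq_trans (sum_roots_step u) _.
apply: leq_trans (leq_add (IH (ltnW uN)) (leqnn _)) _.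
rewrite -big_split; apply: leq_sum => i _.
rewrite [X in _ <= X * _]count_iotaS mulnDl leq_add2l leq_mul2l leq_add2r.
by rewrite trees_mono ?orbT // ltnW.
Qed.

Lemma sum_roots : \sum_(0 <= i < z) Tr N i 1 <= z * 2 ^ d.
Proof.
have : 2 ^ d * \sum_(0 <= i < z) Tr N i 1 <= \sum_(0 <= i < z) k * (Tr N i 1 + 2 ^ d).
  apply: leq_trans (sum_roots_le (leqnn N)) _.
  by apply: leq_sum => i _; rewrite leq_mul2r inc_size orbT.
rewrite -big_distrr big_split /= sum_nat_const_nat subn0.
set s := \sum_(0 <= i < z) _; have d0 : 0 < 2 ^ d by rewrite expn_gt0.
move: k_small; set b := 2 ^ d in d0 * => hk h.
rewrite -(leq_pmul2l d0); nia.
Qed.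

Lemma load_bound i b : i < z -> 2 ^ d <= b < 2 ^ d.+1 -> 2 ^ load d inc N i b <= z * 2 ^ d + 1.
Proof.
move=> iz hb; rewrite -trees_leaf // addn1 ltnS; apply: leq_trans sum_roots.
apply: (@leq_trans (Tr N i 1)).
  by apply: trees_le_root; case/andP: hb => h ->; rewrite (leq_trans _ h) ?expn_gt0.
by rewrite (bigD1_seq i) /= ?mem_index_iota ?iota_uniq // leq_addr.
Qed.

End Greedy.

(** * The program *)

Declare Scope prog_scope.
Delimit Scope prog_scope with prog.
Local Notation "a [+] b" := (Bin OpAdd a b) (at level 50, left associativity) : prog_scope.
Local Notation "a [*] b" := (Bin OpMul a b) (at level 40, left associativity) : prog_scope.
Local Notation "a [/] b" := (Bin OpDiv a b) (at level 40, left associativity) : prog_scope.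
Local Notation "a [%] b" := (Bin OpMod a b) (at level 40, left associativity) : prog_scope.
Local Notation "a [<] b" := (Bin OpLtn a b) (at level 70, no associativity) : prog_scope.
Local Notation "a [==] b" := (Bin OpEqn a b) (at level 70, no associativity) : prog_scope.
Local Notation "# n" := (Cst n) (at level 1, format "# n") : prog_scope.
Local Notation "$ x" := (Var x) (at level 1, x at level 0, format "$ x") : prog_scope.
Local Notation "x ::= e" := (Asg x e) (at level 80, no associativity) : prog_scope.
Local Notation "a <== e" := (Sto a e) (at level 80, no associativity) : prog_scope.
Local Notation "c ;; c'" := (Seq c c') (at level 85, right associativity) : prog_scope.

Local Notation rz := 0 (only parsing).
Local Notation rk := 1 (only parsing).
Local Notation rn := 2 (only parsing).
Local Notation rE := 3 (only parsing).
Local Notation rL := 4 (only parsing).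
Local Notation rB := 5 (only parsing).
Local Notation rw := 6 (only parsing).
Local Notation rX := 7 (only parsing).
Local Notation rIN := 8 (only parsing).
Local Notation rHD := 10 (only parsing).
Local Notation rPR := 11 (only parsing).
Local Notation rTB := 12 (only parsing).
Local Notation rOUT := 13 (only parsing).
Local Notation rt := 14 (only parsing).
Local Notation rp := 15 (only parsing).
Local Notation ri := 16 (only parsing).
Local Notation ru := 17 (only parsing).
Local Notation rx := 18 (only parsing).
Local Notation rl := 19 (only parsing).
Local Notation rr := 20 (only parsing).
Local Notation rj := 21 (only parsing).
Local Notation ry := 22 (only parsing).
Local Notation re := 23 (only parsing).
Local Notation rh := 24 (only parsing).

Local Open Scope prog_scope.

(* Memory of the main branch: the cell of index p < IN = 4 + z + n holds the
   input, and if it lists an element u of S_i, then cell IN + p holds the address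
   of the tree of S_i and cell 2 IN + p the previous occurrence of u, or 0.  The
   n cells from HD = 3 IN on hold the last occurrence of every element.  Then come
   the w primes (from PR), the z trees of 2 B cells each (from TB) and the output
   (from OUT). *)
Definition prog_read : cmd :=
  rz ::= Deref #0;; rk ::= Deref #1;;
  rE ::= Deref #3 [/] Deref #2 [+] #1;; rn ::= $rz [*] $rk.

(** Comparison with n + 1 makes the loop stop at the first power of 2 exceeding n, so L is the bit
    length of n. *)
Definition prog_log : cmd :=
  rL ::= #0;; rt ::= #1;;
  While ($rt [<] $rn [+] #1) (rt ::= $rt [*] #2;; rL ::= $rL [+] #1).

(** The code C_u = {u} of weight 1. Its output may overwrite the input, since n is already in a
    register. *)
Definition prog_identity : cmd :=
  ru ::= #0;;
  While ($ru [<] $rn) (#3 [+] $ru <== $ru;; ru ::= $ru [+] #1);;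
  #0 <== #1;; #1 <== $rn;; #2 <== #3.

Definition prog_layout : cmd :=
  rB ::= #1;; While ($rB [<] #2 [*] $rk) (rB ::= $rB [*] #2);;
  rw ::= $rE [*] ($rL [*] ($rL [+] #3));;
  rIN ::= #4 [+] $rz [+] $rn;;
  rHD ::= #3 [*] $rIN;;
  rPR ::= $rHD [+] $rn;;
  rTB ::= $rPR [+] $rw;;
  rOUT ::= $rTB [+] $rz [*] (#2 [*] $rB).

(** A candidate X is divided by 2, 3, ... up to its least divisor. X is incremented once more after
    the last prime is stored, so that it ends strictly above all w primes and bounds the
    residues. *)
Definition prog_primes : cmd :=
  rX ::= #2;; rj ::= #0;;
  While ($rj [<] $rw)
    (rt ::= #2;;
     While ($rX [%] $rt) (rt ::= $rt [+] #1);;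
     If ($rt [==] $rX) ($rPR [+] $rj <== $rX;; rj ::= $rj [+] #1) Skip;;
     rX ::= $rX [+] #1).

(** A single pass threads the occurrences of each element into a list, newest first. Address 0 can
    mark the end because cell 0 holds z and never an element. *)
Definition prog_links : cmd :=
  rp ::= #4;; ri ::= #0;;
  While ($ri [<] $rz)
    (re ::= $rp [+] #1 [+] Deref $rp;;
     rp ::= $rp [+] #1;;
     rt ::= $rTB [+] $ri [*] (#2 [*] $rB);;
     While ($rp [<] $re)
       ($rIN [+] $rp <== $rt;;
        rh ::= $rHD [+] Deref $rp;;
        #2 [*] $rIN [+] $rp <== Deref $rh;;
        $rh <== $rp;;
        rp ::= $rp [+] #1);;
     ri ::= $ri [+] #1).

Definition prog_descend : cmd :=
  rx ::= #1;;
  While ($rx [<] $rB)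
    (rl ::= #0;; rr ::= #0;;
     rp ::= Deref ($rHD [+] $ru);;
     While ($rp)
       (rt ::= Deref ($rIN [+] $rp) [+] #2 [*] $rx;;
        rl ::= $rl [+] Deref $rt;;
        rr ::= $rr [+] Deref ($rt [+] #1);;
        rp ::= Deref (#2 [*] $rIN [+] $rp));;
     rx ::= #2 [*] $rx [+] ($rr [<] $rl)).

(** The increment is saved in [re] before the climb, whose first step changes the leaf that it is
    read from. Halving a heap index leads to the parent and, after the root, to 0. *)
Definition prog_bump : cmd :=
  rp ::= Deref ($rHD [+] $ru);;
  While ($rp)
    (rt ::= Deref ($rIN [+] $rp) [+] #0;;
     re ::= Deref ($rt [+] $rx) [+] #1;;
     ry ::= $rx [+] #0;;
     While ($ry)
       ($rt [+] $ry <== Deref ($rt [+] $ry) [+] $re;;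
        ry ::= $ry [/] #2);;
     rp ::= Deref (#2 [*] $rIN [+] $rp)).

Definition prog_emit : cmd :=
  rj ::= #0;;
  While ($rj [<] $rw)
    ($rOUT [+] $ru [*] $rw [+] $rj <==
       ($rx [*] $rw [+] $rj) [*] $rX [+] $ru [%] Deref ($rPR [+] $rj);;
     rj ::= $rj [+] #1).

Definition prog_main : cmd :=
  ru ::= #0;;
  While ($ru [<] $rn)
    (prog_descend;; prog_bump;; prog_emit;; ru ::= $ru [+] #1).

Definition prog_code : cmd :=
  prog_layout;; prog_primes;; prog_links;; prog_main;;
  #0 <== $rw;;
  #1 <== #2 [*] $rB [*] $rw [*] $rX;;
  #2 <== $rOUT.

Definition prog : cmd :=
  prog_read;; prog_log;;
  rt ::= $rL [*] $rL [*] $rL [*] $rL [*] $rL [*] ($rE [*] $rE);;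
  If ($rt [<] $rz) prog_code prog_identity.

Local Close Scope prog_scope.

(** * Tools for stepping through the program *)

Fixpoint holds (f : nat -> nat) (l : seq (nat * nat)) : Prop :=
  if l is (x, v) :: l' then f x = v /\ holds f l' else True.

Ltac conjs := repeat match goal with
  | |- _ /\ _ => split | |- and3 _ _ _ => split | |- and4 _ _ _ _ => split end.
Ltac regs := repeat match goal with
  | |- context [upd ?f ?x ?v ?y] =>
      let b := eval lazy in (PeanoNat.Nat.eqb y x) in
      match b with
      | true => change (upd f x v y) with v
      | false => change (upd f x v y) with (f y)
      end
  end.
(* [R] is a tuple of equations for the registers and cells concerned; the side conditions on
   overflow and addresses are then left to [lia]. *)
Tactic Notation "vc" constr(R) := rewrite /=; regs; rewrite ?R; conjs; try by [|lia].
Tactic Notation "asg" constr(R) :=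
  apply: wp_asg; [by []|vc R|vc R|rewrite /=; regs; rewrite ?R].
Tactic Notation "sto" constr(R) :=
  apply: wp_sto; [vc R|vc R|vc R|rewrite /=; regs; rewrite ?R].

Definition prime_list q := [seq p <- iota 0 q | prime p].

Lemma prime_listS q : prime_list q.+1 = prime_list q ++ (if prime q then [:: q] else [::]).
Proof. by rewrite /prime_list -addn1 iotaD filter_cat. Qed.

(** Raising the bound by one adds at most one prime, so the least X with at least w primes below it
    has exactly w. *)
Lemma prime_list_size_min w X : 0 < w -> w <= size (prime_list X) ->
  (forall Y, Y < X -> size (prime_list Y) < w) -> size (prime_list X) = w /\ 2 < X.
Proof.
move=> w0 h1 hX; have X2 : 2 < X.
  rewrite ltnNge; apply/negP => X2; move: X2 h1; case: (X) => [|[|[|y]]] // _; rewrite /prime_list /= => h; lia.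
split=> //; apply/eqP; rewrite eqn_leq h1 andbT.
have := hX X.-1 ltac:(lia); rewrite -{2}(ltn_predK X2) prime_listS size_cat.
by case: prime => /=; lia.
Qed.

(** Decreasing order, because each new occurrence goes to the front of the linked list. *)
Definition incident (Ls : seq (seq nat)) i u := [seq j <- rev (iota 0 i) | u \in nth [::] Ls j].

Lemma incidentS Ls i u :
  incident Ls i.+1 u = (if u \in nth [::] Ls i then [:: i] else [::]) ++ incident Ls i u.
Proof. by rewrite /incident -addn1 iotaD rev_cat filter_cat. Qed.

(** * The sets containing an element, and the points of its codeword *)

Section Incidence.
Variables (z n k d w X : nat) (Ls : seq (seq nat)).
Hypothesis (Ls_k : forall i, i < z -> size (nth [::] Ls i) <= k).

Let inc := incident Ls z.
Let F := bucket d inc.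

Lemma mem_inc i u : (i \in inc u) = (i < z) && (u \in nth [::] Ls i).
Proof. by rewrite mem_filter mem_rev mem_iota andbC. Qed.

Lemma inc_lt u i : i \in inc u -> i < z.
Proof. by rewrite mem_inc => /andP[]. Qed.

Lemma inc_uniq u : uniq (inc u).
Proof. by rewrite filter_uniq // rev_uniq iota_uniq. Qed.

Lemma count_inc i : i < z -> count (fun u => i \in inc u) (iota 0 n) <= size (nth [::] Ls i).
Proof.
move=> iz; rewrite -size_filter uniq_leq_size ?filter_uniq ?iota_uniq // => u.
by rewrite mem_filter mem_inc iz => /andP[].
Qed.

Lemma count_inc_k i : count (fun u => i \in inc u) (iota 0 n) <= k.
Proof.
have [iz|iz] := ltnP i z; first exact: leq_trans (count_inc iz) (Ls_k iz).
rewrite (eq_count (a2 := pred0)) ?count_pred0 // => u.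
by rewrite mem_inc ltnNge iz.
Qed.

(** Mixed radix encoding of the triple (bucket, j, residue): j < w and the residue is less than
    X. *)
Definition code u j := (F u * w + j) * X + u %% nth 0 (prime_list X) j.

Lemma code_lt u j : w <= size (prime_list X) -> j < w ->
  u %% nth 0 (prime_list X) j < X /\ code u j < 2 * 2 ^ d * w * X.
Proof.
move=> sX jw; have := mem_nth 0 (leq_trans jw sX); rewrite mem_filter mem_iota.
set p := nth _ _ _ => /and3P[pp _ pX].
have lt : u %% p < X by apply: ltn_trans pX; rewrite ltn_mod prime_gt0.
split=> //; rewrite /code -/p.
have /andP[_ h] := bucket_bounds d inc u; rewrite -/(F u) expnS in h.
have : (F u).+1 * w <= 2 * 2 ^ d * w by rewrite leq_mul2r h orbT.
rewrite mulSn => h2; have : (F u * w + j).+1 * X <= 2 * 2 ^ d * w * X by rewrite leq_mul2r; lia.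
by rewrite mulSn; lia.
Qed.

End Incidence.

(** * Verification of the program, loop by loop *)

Section Machine.
Variables W s : nat.
Local Notation M := (2 ^ W).
Local Notation wp := (wp W s).

Lemma wp_read z k a b n E (Q : nat -> state -> Prop) T m :
  3 < s -> 4 < M -> z < M -> k < M -> b < M -> b %/ a + 1 = E -> E < M -> z * k = n -> n < M ->
  m 0 = z -> m 1 = k -> m 2 = a -> m 3 = b ->
  (forall f T', holds f [:: (rz, z); (rk, k); (rn, n); (rE, E)] -> T' <= T + 30 ->
     Q T' (f, m)) ->
  wp prog_read Q T (fun=> 0, m).
Proof.
move=> hs hM hz hk hb hE hE' hn hn' m0 m1 m2 m3 hQ.
have R := (m0, m1, m2, m3, hE, hn).
apply: wp_seq; asg R; apply: wp_seq; asg R; apply: wp_seq; asg R; asg R.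
by apply: hQ => //; lia.
Qed.

Lemma wp_log n z k E L (Q : nat -> state -> Prop) T f m :
  2 ^ L.-1 <= n < 2 ^ L -> 0 < L -> 2 * n + 2 < M ->
  holds f [:: (rz, z); (rk, k); (rn, n); (rE, E)] ->
  (forall f' T', holds f' [:: (rz, z); (rk, k); (rn, n); (rE, E); (rL, L)] ->
     T' <= T + L * 20 + 20 -> Q T' (f', m)) ->
  wp prog_log Q T (f, m).
Proof.
move=> /andP[h1 h2] L0 hM /= [fz [fk [fn [fE _]]]] hQ.
have hL i : i < L -> 2 ^ i <= n.
  by move=> iL; apply: leq_trans h1; rewrite leq_exp2l //; lia.
have LM : L < M by apply: leq_trans (ltn_expl L (ltnSn 1)) _; have := hL L.-1 ltac:(lia); have := expnS 2 L.-1; rewrite prednK //; lia.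
apply: wp_seq; asg tt; apply: wp_seq; asg tt.
apply: (wp_while (N := L) (I := fun i T' st => [/\ holds st.1 [:: (rz, z); (rk, k); (rn, n); (rE, E); (rL, i); (rt, 2 ^ i)], st.2 = m & T' <= T + 10 + i * 20])).
- by split=> //=; lia.
- move=> i T' [g m'] iL [/= [gz [gk [gn [gE [gL [gt _]]]]]] -> eT].
  have hi := hL _ iL; have R := (gt, gn, gL).
  split; [vc R|vc R|].
  apply: wp_seq; asg R; asg R.
  split=> //=; rewrite /upd /= ?R; first by rewrite expnS mulnC addn1.
  by lia.
move=> T' [g m'] [/= [gz [gk [gn [gE [gL [gt _]]]]]] -> eT].
have R := (gt, gn, gL); split; [vc R|vc R|].
by apply: hQ => //=; lia.
Qed.

Lemma wp_identity n (Q : nat -> state -> Prop) T f m :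
  3 + n <= s -> s <= M -> 4 < M -> 0 < n -> f rn = n ->
  (forall f' m' T', m' 0 = 1 -> m' 1 = n -> m' 2 = 3 -> (forall u, u < n -> m' (3 + u) = u) ->
     T' <= T + n * 20 + 30 -> Q T' (f', m')) ->
  wp prog_identity Q T (f, m).
Proof.
move=> hs hM h4 n0 fn hQ.
apply: wp_seq; asg tt; apply: wp_seq.
apply: (wp_while (N := n) (I := fun i T' st => [/\ holds st.1 [:: (rn, n); (ru, i)],
  forall u, u < i -> st.2 (3 + u) = u & T' <= T + 10 + i * 20])).
- by split=> //=; lia.
- move=> i T' [g m'] iN [/= [gn [gu _]] hm eT].
  have R := (gn, gu); split; [vc R|vc R|].
  apply: wp_seq; sto R; asg R; split=> //=; regs; rewrite ?R //.
  + by rewrite addn1.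
  + move=> u hu; rewrite /upd; case: eqP => [|ne]; first lia.
    by apply: hm; lia.
  by lia.
move=> T' [g m'] [/= [gn [gu _]] hm eT].
have R := (gn, gu); split; [vc R|vc R|].
apply: wp_seq; sto R; apply: wp_seq; sto R; sto R.
by apply: hQ => //; lia.
Qed.

Lemma wp_layout z k n E L d w IN HD PR TB OUT (Q : nat -> state -> Prop) T f m :
  2 * k <= 2 ^ d -> (forall i, i < d -> 2 ^ i < 2 * k) ->
  w = E * (L * (L + 3)) -> IN = 4 + z + n -> HD = 3 * IN -> PR = HD + n -> TB = PR + w ->
  OUT = TB + z * (2 * 2 ^ d) -> OUT < M -> 0 < z -> 0 < E ->
  holds f [:: (rz, z); (rk, k); (rn, n); (rE, E); (rL, L)] ->
  (forall f' T', holds f' [:: (rz, z); (rn, n); (rB, 2 ^ d); (rw, w); (rIN, IN); (rHD, HD);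
       (rPR, PR); (rTB, TB); (rOUT, OUT)] ->
     T' <= T + d * 20 + 100 -> Q T' (f', m)) ->
  wp prog_layout Q T (f, m).
Proof.
move=> kd hd ew eIN eHD ePR eTB eOUT hM z0 E0 /= [fz [fk [fn [fE [fL _]]]]] hQ.
have zB : 2 * 2 ^ d <= z * (2 * 2 ^ d) by rewrite leq_pmull.
have wL : L * (L + 3) <= w by rewrite ew leq_pmull.
have L3 : L + 3 <= L * (L + 3) + 3 by case: (L) => // y; rewrite mulSn; lia.
apply: wp_seq; asg tt; apply: wp_seq.
apply: (wp_while (N := d) (I := fun i T' st => [/\ holds st.1 [:: (rz, z); (rk, k);
  (rn, n); (rE, E); (rL, L); (rB, 2 ^ i)], st.2 = m & T' <= T + 10 + i * 20])).
- by split=> //=; lia.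
- move=> i T' [g m'] iN [/= [gz [gk [gn [gE [gL [gB _]]]]]] -> eT].
  have hi := hd _ iN; have R := (gB, gk).
  split; [vc R|vc R|].
  asg R; split=> //=; regs; rewrite ?R //; last lia.
  by rewrite expnS mulnC.
move=> T' [g m'] [/= [gz [gk [gn [gE [gL [gB _]]]]]] -> eT].
have R := (gB, gk, gz, gn, gE, gL, esym ew, esym eIN, esym eHD, esym ePR, esym eTB, esym eOUT).
split; [vc R|vc R|].
apply: wp_seq; asg R; apply: wp_seq; asg R.
apply: wp_seq; asg R; apply: wp_seq; asg R; apply: wp_seq; asg R; asg R.
by apply: hQ => //; lia.
Qed.

Section Loops.
Variables (z n d w IN HD PR TB OUT X : nat).
Hypotheses (eIN : IN = 4 + z + n) (eHD : HD = 3 * IN) (ePR : PR = HD + n)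
  (eTB : TB = PR + w) (eOUT : OUT = TB + z * (2 * 2 ^ d)) (es : s = OUT + n * w)
  (sM : s <= M) (XM : X < M) (z0 : 0 < z) (n0 : 0 < n) (w0 : 0 < w).

Let env := [:: (rz, z); (rn, n); (rB, 2 ^ d); (rw, w); (rIN, IN); (rHD, HD);
  (rPR, PR); (rTB, TB); (rOUT, OUT)].

Let zB : 2 * 2 ^ d <= z * (2 * 2 ^ d).
Proof. by rewrite leq_pmull. Qed.
Let nw : w <= n * w.
Proof. by rewrite leq_pmull. Qed.

Lemma wp_primes (Q : nat -> state -> Prop) T f m : w <= size (prime_list X) ->
  (forall Y, Y < X -> size (prime_list Y) < w) ->
  holds f env ->
  (forall f' m' T', holds f' ((rX, X) :: env) ->
     (forall j, j < w -> m' (PR + j) = nth 0 (prime_list X) j) ->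
     (forall a, a < PR \/ TB <= a -> m' a = m a) ->
     T' <= T + X * (X * 20 + 100) + 100 -> Q T' (f', m')) ->
  wp prog_primes Q T (f, m).
Proof.
move=> hX1 hX hf hQ; have [sX X2] := prime_list_size_min w0 hX1 hX.
apply: wp_seq; asg tt; apply: wp_seq; asg tt.
apply: (wp_while (N := X - 2) (I := fun i T' st => [/\
  holds st.1 env /\ holds st.1 [:: (rX, i + 2); (rj, size (prime_list (i + 2)))],
  forall j, j < size (prime_list (i + 2)) -> st.2 (PR + j) = nth 0 (prime_list (i + 2)) j,
  forall a, a < PR \/ TB <= a -> st.2 a = m a
  & T' <= T + 20 + i * (X * 20 + 100)])).
- by split=> //=; lia.
- move=> i T' [g m'] iN [] /= [[gz [gn [gB [gw [gIN [gHD [gPR [gTB [gOUT _]]]]]]]]] [gX [gj _]]] hp hm eT.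
  set q := i + 2 in gX gj hp *; have q1 : 1 < q by rewrite /q; lia.
  have hc : size (prime_list q) < w by apply: hX; rewrite /q; lia.
  have R := (gX, gj, gw).
  split; [vc R|vc R|].
  apply: wp_seq; asg R; apply: wp_seq.
  have pq : pdiv q <= q by rewrite pdiv_leq // ltnW.
  have p1 : 1 < pdiv q by rewrite prime_gt1 // pdiv_prime.
  (* The divisor starts at 2 and the loop stops at the least divisor of q, which is q itself exactly
     when q is prime. *)
  apply: (wp_while (N := pdiv q - 2) (I := fun c T'' st => [/\
    holds st.1 env /\ holds st.1 [:: (rX, q); (rj, size (prime_list q)); (rt, c + 2)],
    st.2 = m' & T'' <= T + 40 + i * (X * 20 + 100) + c * 20])).
  + by split=> //=; lia.
  + move=> c T'' [h m''] cN [] /= [[hz [hn [hB [hw [hIN [hHD [hPR [hTB [hOUT _]]]]]]]]] [hX' [hj [ht _]]]] -> eT'.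
    have R' := (hX', hj, ht); split; [vc R'|vc R'|].
      apply/negP => dv; have := @pdiv_min_dvd q (c + 2) ltac:(lia) dv; lia.
    by asg R'; split=> //=; lia.
  move=> T'' [h m''] [] /= [[hz [hn [hB [hw [hIN [hHD [hPR [hTB [hOUT _]]]]]]]]] [hX' [hj [ht _]]]] -> eT'.
  rewrite subnK // in ht; have R' := (hX', hj, ht, hPR).
  split; [vc R'|vc R'|].
    by apply/eqP; exact: pdiv_dvd.
  have e1 : i.+1 + 2 = q.+1 by rewrite /q; lia.
  have cX : (pdiv q - 2) * 20 <= X * 20 by rewrite /q in pq *; lia.
  apply: wp_seq; apply: wp_if; first by vc R'.
    rewrite /=; regs; rewrite ?R'; case: (pdiv q =P q) => // epq _.
    have prq : prime q by rewrite -epq pdiv_prime.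
    have sq : size (prime_list q.+1) = (size (prime_list q)).+1.
      by rewrite prime_listS prq size_cat addn1.
    apply: wp_seq; sto R'; asg R'; asg R'; rewrite e1; split=> //=; regs.
    * by rewrite sq; repeat split=> //; lia.
    * move=> j; rewrite sq prime_listS prq nth_cat => jq; rewrite /upd.
      case: eqP => [/addnI ->|ne]; first by rewrite ltnn subnn.
      have jq' : j < size (prime_list q) by lia.
      by rewrite jq' hp.
    * move=> a ha; rewrite /upd; case: eqP => [e|_]; first lia.
      exact: hm.
    * by rewrite mulSn; lia.
  rewrite /=; regs; rewrite ?R'; case: (pdiv q =P q) => // epq _.
  have prq : prime q = false by apply/negP => /pdiv_id.
  have sq : prime_list q.+1 = prime_list q by rewrite prime_listS prq cats0.
  apply: wp_skip; asg R'; rewrite e1; split=> //=; regs; rewrite ?sq //.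
    by repeat split=> //; lia.
  by rewrite mulSn; lia.
move=> T' [g m'] [] /= [[gz [gn [gB [gw [gIN [gHD [gPR [gTB [gOUT _]]]]]]]]] [gX [gj _]]] hp hm eT.
rewrite subnK ?(ltnW X2) // in gX gj hp.
have R := (gX, gj, gw, sX); split; [vc R|vc R|].
apply: hQ => //.
  by move=> j jw; apply: hp; rewrite sX.
have : (X - 2) * (X * 20 + 100) <= X * (X * 20 + 100) by rewrite leq_mul2r leq_subr orbT.
by rewrite /=; lia.
Qed.

(** The list starting at input cell [p] leads to the trees of the sets in [r], in this order. The
    bound [b] on its cells makes it insensitive to links created later, for cells from [b] on. *)
Fixpoint chain (m : nat -> nat) (b p : nat) (r : seq nat) : Prop :=
  if r is i :: r' then
    [/\ 0 < p < b, m (IN + p) = TB + i * (2 * 2 ^ d) & chain m b (m (2 * IN + p)) r']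
  else p = 0.

Lemma chain_ext m m' b b' p r : b <= b' -> chain m b p r ->
  (forall q, 0 < q < b -> m' (IN + q) = m (IN + q) /\ m' (2 * IN + q) = m (2 * IN + q)) ->
  chain m' b' p r.
Proof.
move=> bb hc hm; elim: r p hc => //= i r IH p [hp e hc].
have [-> ->] := hm _ hp; split=> //; first lia.
exact: IH.
Qed.

Variables (Ls : seq (seq nat)) (off : nat -> nat).
Hypotheses (off0 : off 0 = 4) (offz : off z <= IN)
  (offS : forall i, i < z -> off i.+1 = off i + 1 + size (nth [::] Ls i))
  (Ls_lt : forall i v, i < z -> v \in nth [::] Ls i -> v < n)
  (Ls_uniq : forall i, i < z -> uniq (nth [::] Ls i)).

(** Each of the remaining z - i sets occupies at least the cell of its size. *)
Lemma off_le i : i <= z -> off i + (z - i) <= IN.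
Proof.
move=> iz; rewrite -{1}(subKn iz); elim: (z - i) (leq_subr i z) => [|c IH] cz.
  by rewrite subn0 addn0.
have := IH (ltnW cz); have := offS (i := z - c.+1) ltac:(lia).
by rewrite (_ : (z - c.+1).+1 = z - c); lia.
Qed.

Lemma wp_links (Q : nat -> state -> Prop) T f m :
  holds f ((rX, X) :: env) ->
  (forall i, i < z -> m (off i) = size (nth [::] Ls i)) ->
  (forall i j, i < z -> j < size (nth [::] Ls i) ->
     m (off i + 1 + j) = nth 0 (nth [::] Ls i) j) ->
  (forall u, u < n -> m (HD + u) = 0) ->
  (forall f' m' T', holds f' ((rX, X) :: env) ->
     (forall u, u < n -> chain m' IN (m' (HD + u)) (incident Ls z u)) ->
     (forall a, a < IN \/ PR <= a -> m' a = m a) ->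
     T' <= T + IN * 100 + 100 -> Q T' (f', m')) ->
  wp prog_links Q T (f, m).
Proof.
move=> [fX hf] m_size m_elt m_head hQ.
apply: wp_seq; asg tt; apply: wp_seq; asg tt.
apply: (wp_while (N := z) (I := fun i T' st => [/\
  holds st.1 ((rX, X) :: env) /\ holds st.1 [:: (rp, off i); (ri, i)],
  forall u, u < n -> chain st.2 (off i) (st.2 (HD + u)) (incident Ls i u),
  forall a, a < IN \/ PR <= a -> st.2 a = m a
  & T' <= T + 20 + off i * 100])).
- by split=> //=; lia.
- move=> i T' [g m'] iz [] /= [[gX [gz [gn [gB [gw [gIN [gHD [gPR [gTB [gOUT _]]]]]]]]]] [gp [gi _]]] hch hm eT.
  set Li := nth [::] Ls i.
  have hoff := off_le iz; have hoffS := offS iz; rewrite -/Li in hoffS.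
  have off4 : 0 < off i.
    have : i <= z by lia.
    by clear -off0 offS; elim: (i) => [|c IH] cz; rewrite ?off0 // offS; lia.
  have m_off : m' (off i) = size Li by rewrite hm ?m_size //; lia.
  have i1 : i * (2 * 2 ^ d) <= z * (2 * 2 ^ d) by rewrite leq_mul2r ltnW ?orbT.
  have R := (gp, gi, gz, gTB, gB, m_off).
  split; [vc R|vc R|].
  apply: wp_seq; asg R; apply: wp_seq; asg R; apply: wp_seq; asg R; apply: wp_seq.
  apply: (wp_while (N := size Li) (I := fun j T' st => [/\
    holds st.1 ((rX, X) :: env) /\ holds st.1 [:: (rp, off i + 1 + j); (ri, i);
      (re, off i + 1 + size Li); (rt, TB + i * (2 * 2 ^ d))],
    forall u, u < n -> chain st.2 (off i + 1 + j) (st.2 (HD + u))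
      ((if u \in take j Li then [:: i] else [::]) ++ incident Ls i u),
    forall a, a < IN \/ PR <= a -> st.2 a = m a
    & T' <= T + 70 + off i * 100 + j * 100])).
  + split=> //=; regs; rewrite ?R ?addn0; last lia.
      by repeat split.
    move=> u hu; rewrite take0 /=; apply: chain_ext (hch _ hu) _; first lia.
    by [].
  + move=> j T'' [h m''] jL [] /= [[hX [hz [hn [hB [hw [hIN [hHD [hPR [hTB [hOUT _]]]]]]]]]] [hp [hi [he [ht _]]]]] hch' hm' eT'.
    set p := off i + 1 + j in hp hch'; set v := nth 0 Li j.
    have pIN : p < IN by rewrite /p; have := off_le (i := i.+1) iz; lia.
    have m_p : m'' p = v by rewrite hm' ?m_elt //; left.
    have v_mem : v \in Li by apply: mem_nth.
    have vn : v < n by apply: Ls_lt v_mem.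
    have m1_p : upd m'' (IN + p) (TB + i * (2 * 2 ^ d)) p = v.
      by rewrite /upd; case: eqP => // ?; lia.
    have m1_h : upd m'' (IN + p) (TB + i * (2 * 2 ^ d)) (HD + v) = m'' (HD + v).
      by rewrite /upd; case: eqP => // ?; lia.
    have R' := (hp, hi, he, ht, hIN, hHD, m1_p, m1_h).
    split; [vc R'|vc R'|].
    apply: wp_seq; sto R'; apply: wp_seq; asg R'; apply: wp_seq; sto R'.
    apply: wp_seq; sto R'; asg R'; split=> //=; regs; rewrite ?R'.
    * by repeat split=> //; rewrite /p; lia.
    * move=> u un; set m3 := upd _ _ _.
      have m3_old q : 0 < q < p -> m3 (IN + q) = m'' (IN + q) /\ m3 (2 * IN + q) = m'' (2 * IN + q).
        by move=> hq; rewrite /m3 /upd; split; repeat (case: eqP => [?|_]; first lia).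
      have m3_set : m3 (IN + p) = TB + i * (2 * 2 ^ d).
        by rewrite /m3 /upd; repeat (case: eqP => [?|?]; try lia).
      have m3_next : m3 (2 * IN + p) = m'' (HD + v).
        by rewrite /m3 /upd; repeat (case: eqP => [?|?]; try lia).
      have m3_head : m3 (HD + u) = if u == v then p else m'' (HD + u).
        rewrite /m3 /upd eqn_add2l; case: eqP => // _.
        by repeat (case: eqP => [?|_]; first lia).
      rewrite m3_head (take_nth 0 jL) mem_rcons inE -/v.
      have pS : p <= off i + 1 + j.+1 by rewrite /p; lia.
      case: (eqVneq u v) => [->|uv] /=; last exact: chain_ext pS (hch' u un) m3_old.
      split; [by rewrite /p; lia|by []|rewrite m3_next].
      (* The elements of [Li] are listed without repetition, so v has not yet been linked to the set
         i. *)
      have := hch' v vn; rewrite (_ : v \in take j Li = false) /=; last first.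
        apply/negP => /(nthP 0)[c]; rewrite size_takel ?(ltnW jL) // => cj.
        rewrite nth_take // => /eqP; rewrite (nth_uniq 0 (ltn_trans cj jL) jL (Ls_uniq iz)).
        by rewrite ltn_eqF.
      by move=> hv; apply: chain_ext pS hv m3_old.
    * move=> a ha; rewrite /upd; do 3!(case: eqP => [?|_]; first lia).
      exact: hm'.
    by lia.
  move=> T'' [h m''] [] /= [[hX [hz [hn [hB [hw [hIN [hHD [hPR [hTB [hOUT _]]]]]]]]]] [hp [hi [he [ht _]]]]] hch' hm' eT'.
  have R' := (hp, hi, he); split; [vc R'|vc R'|].
  asg R'; rewrite hoffS; split=> //=; regs.
  + by repeat split=> //; rewrite addn1.
  + by move=> u un; rewrite incidentS -/Li; have := hch' u un; rewrite take_size.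
  by lia.
move=> T' [g m'] [] /= [[gX [gz [gn [gB [gw [gIN [gHD [gPR [gTB [gOUT _]]]]]]]]]] [gp [gi _]]] hch hm eT.
have R := (gi, gz); split; [vc R|vc R|].
apply: hQ => //=; last by have := off_le (leqnn z); lia.
by move=> u un; apply: chain_ext offz (hch u un) _.
Qed.

Variable k : nat.
Hypotheses (kd : 2 * k <= 2 ^ d) (Ls_k : forall i, i < z -> size (nth [::] Ls i) <= k)
  (lM : 2 * 2 ^ d * w * X < M).

Let inc := incident Ls z.
Local Notation code := (code z d w X Ls).
Let Tr := trees d inc.
Let F := bucket d inc.

(** Trees only grow, so the final bound on the roots holds for all nodes at all times. It excludes
    overflow in the sums that the program forms. *)
Lemma sum_trees_le u x : u <= n -> 0 < x < 2 ^ d.+1 ->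
  \sum_(0 <= i < z) Tr u i x <= z * 2 ^ d.
Proof.
move=> un hx; apply: leq_trans (sum_roots (inc_uniq z Ls) (@inc_lt z Ls) (count_inc_k n Ls_k) kd).
apply: leq_sum => i _; apply: leq_trans (trees_le_root inc u i hx) _.
exact: trees_mono.
Qed.

Lemma tree_le u i x : u <= n -> i < z -> 0 < x < 2 ^ d.+1 -> Tr u i x <= z * 2 ^ d.
Proof.
move=> un iz hx; apply: leq_trans (sum_trees_le un hx).
by rewrite (bigD1_seq i) /= ?mem_index_iota ?iota_uniq // leq_addr.
Qed.

Lemma tree_cost_le u c x : u <= n -> 0 < x < 2 ^ d.+1 ->
  tree_cost (Tr u) (take c (inc u)) x <= z * 2 ^ d.
Proof.
move=> un hx; apply: leq_trans (sum_trees_le un hx).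
apply: (@leq_trans (tree_cost (Tr u) (inc u) x)).
  by rewrite -{2}(cat_take_drop c (inc u)) /tree_cost big_cat leq_addr.
rewrite /tree_cost (sum_inc (inc_uniq z Ls) (@inc_lt z Ls)); apply: leq_sum => i _.
by case: (_ \in _); rewrite ?mul1n ?mul0n.
Qed.

Lemma chain_lt m p r : chain m IN p r -> p < IN.
Proof. by case: r => [|i r] /=; [lia|case; lia]. Qed.

(** Uniqueness of quotient and remainder, used to separate the trees in memory and to decode points
    of codewords. *)
Lemma addr_inj K i y i' x : y < K -> x < K -> i * K + y = i' * K + x -> i = i' /\ y = x.
Proof. by clear; move=> yK xK; have [h|h|->] := ltngtP i i'; nia. Qed.

Lemma inc_mul i : i < z -> i * (2 * 2 ^ d) + 2 * 2 ^ d <= z * (2 * 2 ^ d).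
Proof. by move=> iz; rewrite -mulSnr leq_mul2r iz orbT. Qed.

Lemma tree_cost_takeS (T : nat -> nat -> nat) r c x : c < size r ->
  tree_cost T (take c.+1 r) x = tree_cost T (take c r) x + T (nth 0 r c) x.
Proof. by move=> cr; rewrite /tree_cost (take_nth 0 cr) big_rcons /=. Qed.

Definition linked m := forall u, u < n -> chain m IN (m (HD + u)) (inc u).
Definition stored m (T : nat -> nat -> nat) := forall i x, i < z -> 0 < x < 2 ^ d.+1 ->
  m (TB + i * (2 * 2 ^ d) + x) = T i x.

Lemma wp_descend u (Q : nat -> state -> Prop) T f m : u < n ->
  holds f ((rX, X) :: env) -> f ru = u -> linked m -> stored m (Tr u) ->
  (forall f' T', holds f' ((rX, X) :: env) -> f' ru = u -> f' rx = F u ->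
     T' <= T + 20 + d * (60 + size (inc u) * 60) -> Q T' (f', m)) ->
  wp prog_descend Q T (f, m).
Proof.
move=> un hf fu hl hs hQ; have hch := hl _ un.
apply: wp_seq; asg tt.
apply: (wp_while (N := d) (I := fun t T' st => [/\
  holds st.1 ((rX, X) :: env) /\ holds st.1 [:: (ru, u); (rx, descend (Tr u) (inc u) t)],
  st.2 = m & T' <= T + 10 + t * (60 + size (inc u) * 60)])).
- by split=> //=; lia.
- move=> t T' [g m'] td [] /= [[gX [gz [gn [gB [gw [gIN [gHD [gPR [gTB [gOUT _]]]]]]]]]] [gu [gx _]]] -> eT.
  have := descend_bounds (Tr u) (inc u) t.
  set x := descend _ _ t in gx *; move=> /andP[x1 x2].
  have xd : x < 2 ^ d by apply: leq_trans x2 _; rewrite leq_exp2l.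
  have x0 : 0 < x by apply: leq_trans x1; rewrite expn_gt0.
  have R := (gx, gB, gHD, gu).
  split; [vc R|vc R|].
  have := chain_lt hch => hlt.
  apply: wp_seq; asg R; apply: wp_seq; asg R; apply: wp_seq; asg R; apply: wp_seq.
  apply: (wp_while (N := size (inc u)) (I := fun c T'' st => [/\
    holds st.1 ((rX, X) :: env) /\ holds st.1 [:: (ru, u); (rx, x);
      (rl, tree_cost (Tr u) (take c (inc u)) (2 * x));
      (rr, tree_cost (Tr u) (take c (inc u)) (2 * x + 1))],
    chain m IN (st.1 rp) (drop c (inc u)), st.2 = m &
    T'' <= T + 40 + t * (60 + size (inc u) * 60) + c * 60])).
  + split=> //=; regs; rewrite ?R ?take0 ?drop0 //; last lia.
    by rewrite /tree_cost !big_nil.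
  + move=> c T'' [h m''] cN [] /= [[hX [hz [hn [hB [hw [hIN [hHD [hPR [hTB [hOUT _]]]]]]]]]] [hu [hx [hL [hR _]]]]] hc -> eT'.
    have inc_c := mem_nth 0 cN; have cz := inc_lt inc_c; have hi := inc_mul cz.
    move: hc; rewrite (drop_nth 0 cN) /=; set i := nth 0 _ c in inc_c cz hi *.
    move=> [hp hset hnext]; have hlt' := chain_lt hnext.
    have xl : 0 < 2 * x < 2 ^ d.+1 by rewrite expnS; lia.
    have xr : 0 < 2 * x + 1 < 2 ^ d.+1 by rewrite expnS; lia.
    have ml := hs i _ cz xl; have mr := hs i _ cz xr; rewrite addnA in mr.
    have bl := tree_cost_le c.+1 (ltnW un) xl; have br := tree_cost_le c.+1 (ltnW un) xr.
    rewrite !tree_cost_takeS // -/i in bl br.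
    have R' := (hp, hx, hL, hR, hIN, hset, ml, mr).
    split; [vc R'|vc R'|].
    apply: wp_seq; asg R'; apply: wp_seq; asg R'; apply: wp_seq; asg R'; asg R'.
    split=> //=; regs; rewrite ?R'; last lia.
    by rewrite !tree_cost_takeS.
  move=> T'' [h m''] [] /= [[hX [hz [hn [hB [hw [hIN [hHD [hPR [hTB [hOUT _]]]]]]]]]] [hu [hx [hL [hR _]]]]] hc -> eT'.
  rewrite take_size in hL hR; rewrite drop_size /= in hc.
  have R' := (hc, hx, hL, hR); split; [vc R'|vc R'|].
  asg R'; split=> //=; regs; rewrite ?R'; last by rewrite mulSn; lia.
move=> T' [g m'] [] /= [[gX [gz [gn [gB [gw [gIN [gHD [gPR [gTB [gOUT _]]]]]]]]]] [gu [gx _]]] -> eT.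
have /andP[b1 b2] := bucket_bounds d inc u; rewrite /bucket -/Tr in b1 b2.
have R := (gx, gB); split; [vc R|vc R|].
by apply: hQ => //=; lia.
Qed.

Lemma path_upS b t : path_up b t.+1 = rcons (path_up b t) (b %/ 2 ^ t).
Proof. exact: mkseqS. Qed.

Lemma wp_bump u (Q : nat -> state -> Prop) T f m : u < n ->
  holds f ((rX, X) :: env) -> f ru = u -> f rx = F u -> linked m -> stored m (Tr u) ->
  (forall f' m' T', holds f' ((rX, X) :: env) -> f' ru = u -> f' rx = F u ->
     stored m' (Tr u.+1) -> (forall a, a < TB \/ OUT <= a -> m' a = m a) ->
     T' <= T + 20 + size (inc u) * (100 + d * 20) -> Q T' (f', m')) ->
  wp prog_bump Q T (f, m).
Proof.
move=> un hf fu fx hl hs hQ; have hch := hl _ un.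
have hb := bucket_bounds d inc u; rewrite -/(F u) in hb.
set b := F u in hb fx *; have /andP[b1 b2] := hb.
have d0 : 0 < 2 ^ d by rewrite expn_gt0.
(* The trees after those of the sets in [r] have been updated; for r = [inc u] this is [Tr u.+1] by
   conversion. *)
set bumped := fun (r : seq nat) i x =>
  Tr u i x + ((i \in r) && (x \in path_up b d.+1)) * (Tr u i b).+1.
have hlt := chain_lt hch.
move: (hf) => /= [gX [gz [gn [gB [gw [gIN [gHD [gPR [gTB [gOUT _]]]]]]]]]].
have R := (fu, fx, gHD, gIN, gTB).
apply: wp_seq; asg R.
apply: (wp_while (N := size (inc u)) (I := fun c T' st => [/\
  holds st.1 ((rX, X) :: env) /\ holds st.1 [:: (ru, u); (rx, b)],
  chain m IN (st.1 rp) (drop c (inc u)), stored st.2 (bumped (take c (inc u))) /\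
  (forall a, a < TB \/ OUT <= a -> st.2 a = m a) &
  T' <= T + 10 + c * (100 + d * 20)])).
- split=> //=; regs; rewrite ?drop0 //; last lia.
  split=> // i x iz hx; rewrite hs // /bumped take0 /=; lia.
- move=> c T' [g m'] cN [] /= [[hX [hz [hn [hB [hw [hIN [hHD [hPR [hTB [hOUT _]]]]]]]]]] [hu [hx _]]] hc [hst hm] eT.
  have inc_c := mem_nth 0 cN; have cz := inc_lt inc_c; have hi := inc_mul cz.
  have nin : nth 0 (inc u) c \notin take c (inc u).
    apply/negP => /(nthP 0)[c']; rewrite size_takel ?(ltnW cN) // => cc.
    rewrite nth_take // => /eqP; rewrite (nth_uniq 0 (ltn_trans cc cN) cN (inc_uniq z Ls u)).
    by rewrite ltn_eqF.
  move: hc; rewrite (drop_nth 0 cN) /=; set i := nth 0 _ c in inc_c cz hi nin *.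
  move=> [hp hset hnext]; have hlt' := chain_lt hnext.
  have hset' : m' (IN + g 15) = TB + i * (2 * 2 ^ d) by rewrite hm //; lia.
  have hnext' : m' (2 * IN + g 15) = m (2 * IN + g 15) by rewrite hm //; lia.
  have bl : 0 < b < 2 ^ d.+1 by rewrite b2; lia.
  have mb : m' (TB + i * (2 * 2 ^ d) + b) = Tr u i b.
    by rewrite hst // /bumped (negbTE nin) /= mul0n addn0.
  have Tb := tree_le (ltnW un) cz bl.
  have b2' : b < 2 * 2 ^ d by rewrite -expnS.
  have R' := (hu, hx, hIN, hset', mb, addn0).
  split; [vc R'|vc R'|].
  apply: wp_seq; asg R'; apply: wp_seq; asg R'; apply: wp_seq; asg R'; apply: wp_seq.
  set p := g 15 in hp hset hnext hlt' hset' hnext' *.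
  apply: (wp_while (N := d.+1) (I := fun t T'' st => [/\
    holds st.1 ((rX, X) :: env) /\ holds st.1 [:: (ru, u); (rx, b); (rp, p);
      (rt, TB + i * (2 * 2 ^ d)); (re, Tr u i b + 1); (ry, b %/ 2 ^ t)],
    (forall a, a < TB \/ OUT <= a -> st.2 a = m a),
    (forall i' x, i' < z -> 0 < x < 2 ^ d.+1 -> st.2 (TB + i' * (2 * 2 ^ d) + x) =
       bumped (take c (inc u)) i' x + ((i' == i) && (x \in path_up b t)) * (Tr u i b).+1) &
    T'' <= T + 50 + c * (100 + d * 20) + t * 20])).
  + split=> //=; regs; rewrite ?R' ?expn0 ?divn1 //; last lia.
    by move=> i' x iz hx'; rewrite hst //= andbF mul0n addn0.
  + move=> t T'' [h m''] td [] /= [[kX [kz [kn [kB [kw [kIN [kHD [kPR [kTB [kOUT _]]]]]]]]]] [ku [kx [kp [kt [ke [ky _]]]]]]] hm' hst' eT'.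
    have /andP[y1 y2] := div_exp2_bounds hb (td : t <= d).
    have yb : b %/ 2 ^ t <= b by apply: leq_div.
    have y0 : 0 < b %/ 2 ^ t by apply: leq_trans y1; rewrite expn_gt0.
    set y := b %/ 2 ^ t in ky y1 y2 yb y0 *.
    have yl : 0 < y < 2 ^ d.+1 by rewrite y0; apply: leq_ltn_trans b2.
    (* The ancestors of a leaf are distinct, so this climb has not touched the cell of y yet. *)
    have ynin : y \notin path_up b t.
      apply/negP => /path_up_mem[j jt e].
      by have := div_exp2_inj hb (td : t <= d) (ltnW (leq_trans jt td)) e; lia.
    have my : m'' (TB + i * (2 * 2 ^ d) + y) = Tr u i y.
      rewrite hst' // /bumped (negbTE nin) (negbTE ynin) andbF; lia.
    have Ty := tree_le (ltnW un) cz yl.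
    have R2 := (ku, kx, kp, kt, ke, ky, my).
    split; [vc R2|vc R2|].
    apply: wp_seq; sto R2; asg R2; split=> //=; regs; rewrite ?R2.
    * by repeat split=> //; rewrite /y divn_exp2S.
    * move=> a ha; rewrite /upd; case: eqP => [?|_]; [lia|exact: hm'].
    * move=> i' x iz hx'; rewrite path_upS mem_rcons inE -/y /upd.
      case: eqP => [e|ne].
        have xK : x < 2 * 2 ^ d by rewrite -expnS; case/andP: hx'.
        have yK : y < 2 * 2 ^ d by lia.
        have eK : i' * (2 * 2 ^ d) + x = i * (2 * 2 ^ d) + y by lia.
        have [ei ex] := addr_inj xK yK eK.
        rewrite ei ex !eqxx /bumped (negbTE nin) /=; lia.
      rewrite hst' //; case: (eqVneq i' i) => //= ei; case: (eqVneq x y) => //= ex.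
      by case: ne; rewrite ei ex.
    by lia.
  move=> T'' [h m''] [] /= [[kX [kz [kn [kB [kw [kIN [kHD [kPR [kTB [kOUT _]]]]]]]]]] [ku [kx [kp [kt [ke [ky _]]]]]]] hm' hst' eT'.
  have m_next : m'' (2 * IN + p) = m (2 * IN + p) by rewrite hm' //; lia.
  rewrite divn_small // in ky.
  have R2 := (ku, kx, kp, kt, ke, ky, kIN, m_next).
  split; [vc R2|vc R2|].
  asg R2; split=> //=; regs; rewrite ?R2 //; last by rewrite !mulSn; lia.
  split=> // i' x iz hx'; rewrite hst' // /bumped (take_nth 0 cN) -/i mem_rcons inE.
  case: (eqVneq i' i) => [->|_] /=; last by rewrite mul0n addn0.
  by rewrite (negbTE nin) /=; lia.
move=> T' [g m'] [] /= [[hX [hz [hn [hB [hw [hIN [hHD [hPR [hTB [hOUT _]]]]]]]]]] [hu [hx _]]] hc [hst hm] eT.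
rewrite drop_size /= in hc; rewrite take_size in hst.
have R' := (hc, hu); split; [vc R'|vc R'|].
by apply: hQ => //=; lia.
Qed.

Lemma wp_emit u (Q : nat -> state -> Prop) T f m : u < n -> w <= size (prime_list X) ->
  holds f ((rX, X) :: env) -> f ru = u -> f rx = F u ->
  (forall j, j < w -> m (PR + j) = nth 0 (prime_list X) j) ->
  (forall f' m' T', holds f' ((rX, X) :: env) -> f' ru = u ->
     (forall j, j < w -> m' (OUT + u * w + j) = code u j) ->
     (forall a, a < OUT + u * w -> m' a = m a) ->
     T' <= T + 20 + w * 40 -> Q T' (f', m')) ->
  wp prog_emit Q T (f, m).
Proof.
move=> un sX hf fu fx hp hQ; move: (hf) => /= [gX [gz [gn [gB [gw [gIN [gHD [gPR [gTB [gOUT _]]]]]]]]]].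
apply: wp_seq; asg tt.
apply: (wp_while (N := w) (I := fun j T' st => [/\
  holds st.1 ((rX, X) :: env) /\ holds st.1 [:: (ru, u); (rx, F u); (rj, j)],
  (forall j', j' < j -> st.2 (OUT + u * w + j') = code u j'),
  (forall a, a < OUT + u * w -> st.2 a = m a) & T' <= T + 10 + j * 40])).
- by split=> //=; lia.
- move=> j T' [g m'] jw [] /= [[hX [hz [hn [hB [hw [hIN [hHD [hPR [hTB [hOUT _]]]]]]]]]] [hu [hx [hj _]]]] hc hm eT.
  have mp : m' (PR + j) = nth 0 (prime_list X) j by rewrite hm ?hp //; lia.
  have [c1 c2] := code_lt z d Ls u sX jw; rewrite /code -/inc -/F in c2.
  have uw : u * w + w <= n * w by rewrite -mulSnr leq_mul2r un orbT.
  have Xpos : 0 < X by lia.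
  have le1 : F u * w + j <= (F u * w + j) * X by rewrite leq_pmulr.
  have R := (hu, hx, hj, hOUT, hw, hX, hPR, mp).
  split; [vc R|vc R|].
  apply: wp_seq; sto R; asg R; split=> //=; regs; rewrite ?R.
  + by repeat split=> //; rewrite addn1.
  + move=> j' jj; rewrite /upd; case: eqP => [/addnI ->|ne]; first by [].
    apply: hc; case: (eqVneq j' j) => [e|]; [by case: ne; rewrite e|lia].
  + by move=> a ha; rewrite /upd; case: eqP => [?|_]; [lia|exact: hm].
  by lia.
move=> T' [g m'] [] /= [[hX [hz [hn [hB [hw [hIN [hHD [hPR [hTB [hOUT _]]]]]]]]]] [hu [hx [hj _]]]] hc hm eT.
have R := (hj, hw); split; [vc R|vc R|].
by apply: hQ => //=; lia.
Qed.

Lemma linked_ext m m' : (forall a, a < TB -> m' a = m a) -> linked m -> linked m'.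
Proof.
move=> hm hl u un; rewrite hm; last lia.
by apply: chain_ext (leqnn _) (hl u un) _ => q hq; rewrite !hm //; lia.
Qed.

Let degs u := \sum_(0 <= v < u) size (inc v).

(** Double counting of incidences. The inner loops of descent and update at u are as long as the
    list of sets containing u, so this bounds their total over all u. *)
Lemma degs_le : degs n <= z * k.
Proof.
rewrite /degs; under eq_bigr => v _ do rewrite -sum1_size (sum_inc (inc_uniq z Ls) (@inc_lt z Ls)).
rewrite exchange_big /= -[z in z * k]subn0 -sum_nat_const_nat.
apply: leq_sum => i _; apply: leq_trans (count_inc_k n Ls_k i).
rewrite -sum1_count [X in _ <= X]big_mkcond /= /index_iota subn0; apply: leq_sum => u _.
by rewrite muln1; case: (_ \in _).
Qed.

Definition emitted m u := forall v j, v < u -> j < w -> m (OUT + v * w + j) = code v j.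

Lemma wp_main (Q : nat -> state -> Prop) T f m : w <= size (prime_list X) ->
  holds f ((rX, X) :: env) -> linked m -> stored m (Tr 0) ->
  (forall j, j < w -> m (PR + j) = nth 0 (prime_list X) j) ->
  (forall f' m' T', holds f' ((rX, X) :: env) -> emitted m' n ->
     T' <= T + 20 + n * (120 + d * 60 + w * 40) + z * k * (100 + d * 80) -> Q T' (f', m')) ->
  wp prog_main Q T (f, m).
Proof.
move=> sX hf hl hs hp hQ.
apply: wp_seq; asg tt.
apply: (wp_while (N := n) (I := fun u T' st => [/\
  holds st.1 ((rX, X) :: env) /\ st.1 ru = u,
  linked st.2 /\ stored st.2 (Tr u),
  (forall j, j < w -> st.2 (PR + j) = nth 0 (prime_list X) j) /\ emitted st.2 u &
  T' <= T + 10 + u * (120 + d * 60 + w * 40) + degs u * (100 + d * 80)])).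
- by split=> //=; lia.
- move=> u T' [g m'] un [] [hg gu] [hl' hs'] [hp' he'] eT.
  have gn : g rn = n by case: (hg) => _ [_ []].
  simpl in gu, hl', hs', hp', he'; have R := (gu, gn).
  split; [vc R|vc R|].
  apply: wp_seq; apply: (wp_descend un hg gu hl' hs') => f1 T1 h1 u1 x1 e1.
  apply: wp_seq; apply: (wp_bump un h1 u1 x1 hl' hs') => f2 m2 T2 h2 u2 x2 s2 fr2 e2.
  have hp2 j : j < w -> m2 (PR + j) = nth 0 (prime_list X) j.
    by move=> jw; rewrite fr2 ?hp' //; lia.
  have hl2 : linked m2 by apply: linked_ext hl' => a ha; apply: fr2; left.
  have he2 : emitted m2 u.
    by move=> v j vu jw; rewrite fr2 ?he' //; lia.
  apply: wp_seq; apply: (wp_emit un sX h2 u2 x2 hp2) => f3 m3 T3 h3 u3 em3 fr3 e3.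
  have OUTu : OUT <= OUT + u * w by apply: leq_addr.
  have un' : u < M by lia.
  have R3 := u3; asg R3; split.
  + by split; [exact: h3|rewrite /=; regs; rewrite addn1].
  + split; first by apply: linked_ext hl2 => a ha; apply: fr3; lia.
    move=> i x iz hx; rewrite /= fr3 ?s2 //.
    by have := inc_mul iz; rewrite expnS in hx; lia.
  + split=> [j jw|v j vu jw] /=; first by rewrite fr3 ?hp2 //; lia.
    move: vu; rewrite ltnS leq_eqVlt => /predU1P[->|vu]; first exact: em3.
    rewrite fr3 ?he2 //.
    have : v.+1 * w <= u * w by rewrite leq_mul2r vu orbT.
    by rewrite mulSn; lia.
  rewrite /degs big_nat_recr //= -/(degs u).
  move: (degs u) (size (inc u)) e1 e2 e3 eT => D c; clear; move: T' T1 T2 T3 T => T0 T1 T2 T3 T.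
  by rewrite /= !mulnDr !mulnDl; lia.
move=> T' [g m'] [] [hg gu] [hl' hs'] [hp' he'] eT.
have gn : g rn = n by case: (hg) => _ [_ []].
simpl in gu; have R := (gu, gn); split; [vc R|vc R|].
apply: hQ => //=.
have : degs n * (100 + d * 80) <= z * k * (100 + d * 80) by rewrite leq_mul2r degs_le orbT.
by lia.
Qed.

Lemma wp_code E L (Q : nat -> state -> Prop) T f m :
  w <= size (prime_list X) -> (forall Y, Y < X -> size (prime_list Y) < w) ->
  (forall i, i < d -> 2 ^ i < 2 * k) -> w = E * (L * (L + 3)) -> 0 < E ->
  holds f [:: (rz, z); (rk, k); (rn, n); (rE, E); (rL, L)] ->
  (forall i, i < z -> m (off i) = size (nth [::] Ls i)) ->
  (forall i j, i < z -> j < size (nth [::] Ls i) ->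
     m (off i + 1 + j) = nth 0 (nth [::] Ls i) j) ->
  (forall a, IN <= a -> m a = 0) ->
  (forall f' m' T', m' 0 = w -> m' 1 = 2 * 2 ^ d * w * X -> m' 2 = OUT -> emitted m' n ->
     T' <= T + 500 + d * 20 + X * (X * 20 + 100) + IN * 100 +
       n * (120 + d * 60 + w * 40) + z * k * (100 + d * 80) -> Q T' (f', m')) ->
  wp prog_code Q T (f, m).
Proof.
move=> sX mX hd ew E0 hf msz mel m0 hQ.
apply: wp_seq; apply: (wp_layout kd hd ew eIN eHD ePR eTB eOUT _ z0 E0 hf) => [|f1 T1 h1 e1]; first lia.
apply: wp_seq; apply: (wp_primes sX mX h1) => f2 m2 T2 h2 p2 fr2 e2.
have offi i : i < z -> off i + 1 + size (nth [::] Ls i) <= IN.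
  by move=> iz; rewrite -offS //; have := off_le iz; lia.
apply: wp_seq; apply: (wp_links h2).
- by move=> i iz; rewrite fr2 ?msz //; have := offi _ iz; lia.
- by move=> i j iz ij; rewrite fr2 ?mel //; have := offi _ iz; lia.
- by move=> u un; rewrite fr2 ?m0 //; lia.
move=> f3 m3 T3 h3 l3 fr3 e3.
apply: wp_seq; apply: (wp_main sX h3 l3).
- move=> i x iz hx; rewrite fr3 ?fr2 ?m0 //; lia.
- by move=> j jw; rewrite fr3 ?p2 //; lia.
move=> f4 m4 T4 h4 em4 e4.
move: (h4) => /= [gX [gz [gn [gB [gw [gIN [gHD [gPR [gTB [gOUT _]]]]]]]]]].
have l1 : 2 * 2 ^ d <= 2 * 2 ^ d * w by rewrite leq_pmulr.
have [_ X2] := prime_list_size_min w0 sX mX.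
have l2 : 2 * 2 ^ d * w <= 2 * 2 ^ d * w * X by rewrite leq_pmulr; lia.
have R := (gw, gB, gX, gOUT).
apply: wp_seq; sto R; apply: wp_seq; sto R; sto R.
apply: hQ => //; last lia.
by move=> v j vn jw; rewrite -(em4 v j vn jw) /upd; do 3!(case: eqP => [?|_]; first lia).
Qed.

End Loops.
End Machine.

(** * The input and the collisions *)

Definition input_words (z k a b : nat) (Ls : seq (seq nat)) : seq nat :=
  [:: z; k; a; b] ++ flatten [seq size r :: r | r <- Ls].

Definition input_pos (Ls : seq (seq nat)) (i : nat) : nat :=
  4 + sumn [seq (size r).+1 | r <- take i Ls].

Lemma input_posS Ls i : i < size Ls ->
  input_pos Ls i.+1 = input_pos Ls i + 1 + size (nth [::] Ls i).
Proof.
by move=> iz; rewrite /input_pos (take_nth [::] iz) map_rcons -cats1 sumn_cat /=; lia.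
Qed.

Lemma size_input_words z k a b Ls :
  size (input_words z k a b Ls) = input_pos Ls (size Ls).
Proof.
rewrite /input_words /input_pos take_size size_cat size_flatten /shape -map_comp.
by congr (_ + sumn _); apply: eq_map.
Qed.

Lemma nth_input_words z k a b Ls i j : i < size Ls -> j <= size (nth [::] Ls i) ->
  nth 0 (input_words z k a b Ls) (input_pos Ls i + j) =
  nth 0 (size (nth [::] Ls i) :: nth [::] Ls i) j.
Proof.
move=> iz0 js0; rewrite /input_words /input_pos -addnA nth_cat; case: ltnP => h; first by rewrite /= in h; lia.
rewrite addKn {h}; move: iz0 js0; elim: Ls i => [|r Ls IH] [|i] //= iz js.
  by rewrite add0n -cat_cons nth_cat /= ltnS js.
rewrite nth_cat; case: ltnP => h; first by lia.
by rewrite -IH //; congr (nth _ _ _); lia.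
Qed.

Lemma sumn_input_le (Ls : seq (seq nat)) k : (forall r, r \in Ls -> size r <= k) ->
  sumn [seq (size r).+1 | r <- Ls] <= size Ls * k + size Ls.
Proof.
elim: Ls => [|r Ls IH] //= hk; have h1 := hk r (mem_head _ _).
have : sumn [seq (size r).+1 | r <- Ls] <= size Ls * k + size Ls.
  by apply: IH => r' h; apply: hk; rewrite inE h orbT.
by rewrite mulSn; lia.
Qed.

Lemma count_has_le (T S : Type) (a : T -> S -> bool) (r : seq T) (t : seq S) :
  count (fun x => has (a x) t) r <= \sum_(y <- t) count (a^~ y) r.
Proof.
elim: t => [|y t IH]; first by rewrite big_nil (eq_count (a2 := pred0)) ?count_pred0.
rewrite big_cons; apply: leq_trans (leq_add (leqnn _) IH).
rewrite -(count_predUI (a^~ y) (fun x => has (a x) t)); apply: leq_trans (leq_addr _ _).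
by apply: sub_count => x.
Qed.

(** * How much of a codeword a set can cover *)

Section Collisions.
Variables (z n d w X k L : nat) (Ls : seq (seq nat)).
Hypotheses (sX : size (prime_list X) = w) (nL : n < 2 ^ L)
  (kd : 2 * k <= 2 ^ d) (zd : z * 2 ^ d + 1 < 2 ^ L.+3)
  (Ls_lt : forall i v, i < z -> v \in nth [::] Ls i -> v < n)
  (Ls_uniq : forall i, i < z -> uniq (nth [::] Ls i))
  (Ls_k : forall i, i < z -> size (nth [::] Ls i) <= k).

Let F := bucket d (incident Ls z).
Local Notation code := (code z d w X Ls).

Lemma code_inj u v j j' : j < w -> j' < w -> code u j = code v j' ->
  [/\ F u = F v, j = j' & u %% nth 0 (prime_list X) j = v %% nth 0 (prime_list X) j].
Proof.
move=> jw jw'; rewrite /code -/F => e.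
have mod_lt x c : c < w -> x %% nth 0 (prime_list X) c < X.
  rewrite -sX => cw; have := mem_nth 0 cw; rewrite mem_filter mem_iota.
  move=> /and3P[pp _ pX]; apply: leq_trans (ltn_pmod x (prime_gt0 pp)) (ltnW pX).
have [e1 e2] := addr_inj (mod_lt u j jw) (mod_lt v j' jw') e.
have [e3 e4] := addr_inj jw jw' e1.
by split=> //; rewrite e2 e4.
Qed.

(** 2^load <= z 2^d + 1 < 2^(L + 3) by the potential argument. *)
Lemma load_le i b : i < z -> 2 ^ d <= b < 2 ^ d.+1 ->
  count (fun v => F v == b) (nth [::] Ls i) <= L.+2.
Proof.
move=> iz hb.
have lu u : uniq (incident Ls z u) by exact: inc_uniq.
have ll u i' : i' \in incident Ls z u -> i' < z by exact: inc_lt.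
have lc := count_inc_k n Ls_k.
have := load_bound lu ll lc kd iz hb => /leq_ltn_trans/(_ zd).
rewrite ltn_exp2l // ltnS; apply: leq_trans.
rewrite /load -!size_filter; apply: uniq_leq_size; first by rewrite filter_uniq ?Ls_uniq.
move=> v; rewrite [in X in X -> _]mem_filter => /andP[/eqP e vi].
by rewrite mem_filter mem_inc iz vi mem_iota (Ls_lt iz vi) -e eqxx.
Qed.

Lemma collisions_le i u : i < z -> u < n -> u \notin nth [::] Ls i ->
  count (fun j => has (fun v => has (fun j' => code u j == code v j') (iota 0 w))
    (nth [::] Ls i)) (iota 0 w) <= L.+2 * L.
Proof.
move=> iz un ui; set ps := prime_list X.
have pu : uniq ps by rewrite filter_uniq ?iota_uniq.
have pa : all prime ps by apply/allP => p; rewrite mem_filter => /andP[].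
apply: (@leq_trans (count (fun j => has (fun v => (F v == F u) &&
    (u %% nth 0 ps j == v %% nth 0 ps j)) (nth [::] Ls i)) (iota 0 w))).
  rewrite -!size_filter; apply: uniq_leq_size; first by rewrite filter_uniq ?iota_uniq.
  move=> j; rewrite !mem_filter => /andP[/hasP[v vi /hasP[j']]]; rewrite !mem_iota /= => j'w /eqP e jw.
  have [e1 e2 e3] := code_inj jw j'w e.
  by rewrite jw andbT; apply/hasP; exists v => //; rewrite e1 e3 !eqxx.
apply: leq_trans (count_has_le _ _ _) _.
apply: (@leq_trans (\sum_(v <- nth [::] Ls i | F v == F u) L)).
  rewrite [X in _ <= X]big_mkcond big_seq [X in _ <= X]big_seq /=; apply: leq_sum => v vi.
  case: eqP => [_|_] /=; last by rewrite count_pred0.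
  have -> : count (fun j => u %% nth 0 ps j == v %% nth 0 ps j) (iota 0 w) =
      count (fun p => u %% p == v %% p) ps.
    by rewrite -[in RHS](mkseq_nth 0 ps) /mkseq sX count_map; apply: eq_count.
  have vn := Ls_lt iz vi; apply: count_eqmod_primes => //; try exact: ltn_trans nL.
  by apply: contraNneq ui => ->.
rewrite -big_filter sum_seq_const size_filter leq_mul2r load_le ?orbT //.
exact: bucket_bounds.
Qed.

End Collisions.

(** * Correctness of the program *)

(* Locked, lest conversion compute it in unary. *)
Definition million := locked (1000 * 1000).

Lemma million_gt0 : 0 < million.
Proof. by rewrite /million -lock. Qed.

Section Correctness.
Variables (W z k a b n L E : nat) (Ls : seq (seq nat)).
Hypotheses (z0 : 0 < z) (k0 : 0 < k) (en : n = z * k) (sLs : size Ls = z)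
  (Ls_k : forall r, r \in Ls -> size r <= k) (Ls_uniq : forall r, r \in Ls -> uniq r)
  (Ls_lt : forall r v, r \in Ls -> v \in r -> v < n)
  (eE : E = b %/ a + 1) (hL : 2 ^ L.-1 <= n < 2 ^ L)
  (bW : b < 2 ^ W) (W_large : forall x c, c <= 30 -> x < (n + E) ^ c -> x < 2 ^ W).

Let input := input_words z k a b Ls.

(* [cd u] lists the codeword of u; the bad positions of u are the ones where it
   meets the codeword of some member of the i-th set. *)
Definition solved w l t s (cd : nat -> nat -> nat) cf :=
  [/\ [/\ 0 < w, computes W s t (compile prog 0) input cf,
          [/\ memory cf 0 = w, memory cf 1 = l, 3 <= s & memory cf 2 + n * w <= s]
        & forall u j, u < n -> j < w -> memory cf (memory cf 2 + u * w + j) = cd u j],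
      [/\ forall u j, u < n -> j < w -> cd u j < l
        & forall u j j', u < n -> j < w -> j' < w -> cd u j = cd u j' -> j = j'],
      forall i u, i < z -> u < n -> u \notin nth [::] Ls i ->
        count (fun j => has (fun v => has (fun j' => cd u j == cd v j') (iota 0 w))
          (nth [::] Ls i)) (iota 0 w) * E <= w
    & [/\ w <= million * (L ^ 2 * E), l <= million * (k * L ^ 5 * E ^ 2),
          t <= million * (n * L ^ 2 * E) & s <= million * (n * L ^ 2 * E)]].

Let n0 : 0 < n. Proof. by rewrite en muln_gt0 z0. Qed.
Let E0 : 0 < E. Proof. by rewrite eE addn1. Qed.
Let L0 : 0 < L. Proof. by move: hL n0; case: (L) => // /andP[_]; lia. Qed.
Let Ln : L <= n.
Proof. by case/andP: hL => h _; apply: leq_trans h; have := ltn_expl L.-1 (ltnSn 1); lia. Qed.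
Let zn : z <= n. Proof. by rewrite en leq_pmulr. Qed.
Let kn : k <= n. Proof. by rewrite en leq_pmull. Qed.
Let G := n + E.
Let G2 : 1 < G. Proof. by rewrite /G; lia. Qed.

Let Ls_mem i : i < z -> nth [::] Ls i \in Ls.
Proof. by move=> iz; rewrite mem_nth ?sLs. Qed.

Let pos_le : input_pos Ls z <= 4 + z + n.
Proof. by rewrite /input_pos -sLs take_size; have := sumn_input_le Ls_k; rewrite sLs en; lia. Qed.

Lemma LE_gt0 c e : 0 < L ^ c * E ^ e.
Proof. by rewrite muln_gt0 !expn_gt0 L0 E0. Qed.

Lemma wp_prog s (Q : nat -> state -> Prop) : 3 < s ->
  (L ^ 5 * E ^ 2 < z ->
     forall f, holds f [:: (rz, z); (rk, k); (rn, n); (rE, E); (rL, L)] ->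
     forall T, T <= 200 + L * 20 -> wp W s prog_code (fun T => Q (T + 2)) T (f, nth 0 input)) ->
  (z <= L ^ 5 * E ^ 2 ->
     forall f, holds f [:: (rz, z); (rk, k); (rn, n); (rE, E); (rL, L)] ->
     forall T, T <= 200 + L * 20 -> wp W s prog_identity Q T (f, nth 0 input)) ->
  wp W s prog Q 0 (fun=> 0, nth 0 input).
Proof.
move=> s3 hbig hsmall.
have LG : L <= G by apply: leq_trans Ln (leq_addr _ _).
have EG : E <= G by apply: leq_addl.
(* As G >= 2, constants are absorbed in powers of G, and one spare power makes the inequality
   strict; the other bounds on words are obtained alike. *)
have LE : L ^ 5 * E ^ 2 < 2 ^ W.
  apply: (@W_large _ 8) => //; apply: (@leq_ltn_trans (G ^ 7)); last by rewrite ltn_exp2l.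
  by rewrite (_ : 7 = 5 + 2) // expnD leq_mul // leq_exp2r.
have b1 x : x <= 4 * G -> x < 2 ^ W.
  move=> hx; apply: (@W_large _ 4) => //; apply: (@leq_ltn_trans (G ^ 3)); last by rewrite ltn_exp2l.
  apply: leq_trans hx _; rewrite expnSr leq_mul2r.
  by apply/orP; right; rewrite (@leq_exp2r 2 G 2).
apply: wp_seq; apply: (@wp_read _ _ z k a b n E) => //; try (apply: b1; rewrite /G; lia).
move=> f T hf hT.
apply: wp_seq; have log_spec := @wp_log W s n z k E L; apply: (log_spec _ T f _ hL L0 _ hf); first by apply: b1; rewrite /G; lia.
move=> {hf} f' T' hf' hT'; move: (hf') => /= [fz [fk [fn [fE [fL _]]]]].
have R := (fz, fL, fE).
have e1 : L * L * L * L * L * (E * E) = L ^ 5 * E ^ 2 by rewrite !expnS !expn0; lia.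
have [M1 M2 M3] : [/\ L * L * L < 2 ^ W, L * L * L * L < 2 ^ W & L * L * L * L * L < 2 ^ W].
  have hc c : c <= 5 -> L ^ c <= L ^ 5 * E ^ 2.
    by move=> c5; apply: leq_trans (leq_pmulr _ _); rewrite ?expn_gt0 ?E0 // leq_pexp2l.
  have := hc 3 isT; have := hc 4 isT; have := hc 5 isT; rewrite !expnS !expn0 -?e1.
  by move: LE; rewrite !expnS !expn0; split; lia.
have M0 : L * L < 2 ^ W by apply: leq_ltn_trans M1; rewrite leq_pmulr.
have M4 : E * E < 2 ^ W.
  apply: leq_ltn_trans LE; rewrite -mulnn; apply: leq_pmull; by rewrite expn_gt0 L0.
apply: wp_seq; apply: wp_asg => //; first by vc R; rewrite e1.
  by rewrite /= ?R e1.
rewrite /= ?R e1; apply: wp_if.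
- by vc R.
- rewrite /=; regs; rewrite ?R; case: ltnP => // lt _.
  by apply: hbig => //; lia.
rewrite /=; regs; rewrite ?R; case: ltnP => // le _.
by apply: hsmall => //; lia.
Qed.

Lemma solved_small : z <= L ^ 5 * E ^ 2 -> exists w l t s cd cf, solved w l t s cd cf.
Proof.
move=> small; set s := 4 + z + n.
have sM : s < 2 ^ W.
  apply: (@W_large _ 4) => //; apply: (@leq_ltn_trans (G ^ 3)); last by rewrite ltn_exp2l.
  apply: (@leq_trans (4 * G)); first by rewrite /s /G; lia.
  rewrite expnSr leq_mul2r; by apply/orP; right; rewrite (@leq_exp2r 2 G 2).
have [t [st [run [m0 m1 m2 mu ht]]]] : wp W s prog (fun T st => [/\ st.2 0 = 1, st.2 1 = n, st.2 2 = 3,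
    forall u, u < n -> st.2 (3 + u) = u & T <= 300 + L * 20 + n * 20]) 0 (fun=> 0, nth 0 input).
  apply: wp_prog; first by rewrite /s; lia.
    by move=> big; move: (leq_trans big small); rewrite ltnn.
  move=> _ f /= [fz [fk [fn _]]] T hT.
  apply: wp_identity fn _ => //; try (rewrite /s; lia).
  by move=> f' m' T' h0 h1 h2 hu hT'; split=> //; lia.
have [|cf [hc hm]] := exec_computes _ run.
  by rewrite (ltnW sM) size_input_words sLs pos_le.
have hnL : n <= n * L ^ 2 * E by rewrite -mulnA leq_pmulr // -[E]expn1 LE_gt0.
have hL2 : L <= L ^ 2 * E.
  by rewrite -mulnn -mulnA leq_pmulr // muln_gt0 L0.
have hLn : L ^ 2 * E <= n * L ^ 2 * E by rewrite -mulnA leq_pmull.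
exists 1, n, t, s, (fun u _ => u), cf; split.
- split=> //; first by rewrite hm; split=> //; rewrite /s; lia.
  move=> u [|//] un _; rewrite hm m2 muln1 addn0; exact: mu.
- by split=> // u [|//] [|//].
- move=> i u iz un ui; rewrite (eq_count (a2 := pred0)) ?count_pred0 // => j.
  apply/negP => /hasP[v vi /hasP[j' _ /eqP e]].
  by move: ui; rewrite e vi.
split.
- apply: (@leq_trans (L ^ 2 * E)); last by rewrite leq_pmull ?million_gt0.
  by rewrite muln_gt0 expn_gt0 L0.
- rewrite en mulnC -mulnA; apply: (@leq_trans (k * (L ^ 5 * E ^ 2))); last by rewrite leq_pmull ?million_gt0.
  by rewrite leq_mul2l small orbT.
- rewrite add0n in ht; move: ht hL2 hLn hnL n0; rewrite /million -lock.
  by move: (n * L ^ 2 * E) (L ^ 2 * E); clear; lia.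
by move: hnL zn n0; rewrite /s /million -lock; move: (n * L ^ 2 * E); clear; lia.
Qed.

Lemma solved_large : L ^ 5 * E ^ 2 < z -> exists w l t s cd cf, solved w l t s cd cf.
Proof.
move=> large; have [w ew] : exists w, w = E * (L * (L + 3)) by eexists.
have LE0 := LE_gt0.
have n2 : 1 < n.
  by apply: leq_trans zn; apply: leq_ltn_trans large; rewrite LE0.
have L2 : 1 < L by move: hL; case: (L) L0 => [|[|//]] // _; rewrite expn1; lia.
have Lexp : L <= 2 ^ L by apply: ltnW (ltn_expl _ _).
have w0 : 0 < w by rewrite ew !muln_gt0 E0 L0 addn3.
have w_le : w <= 4 * (L ^ 2 * E).
  by rewrite ew -mulnn; move: L0; clear; move: E L => e l; nia.
(* E <= L^5 E^2 < z <= n < 2^L: here the large case keeps the primes polynomial in n. *)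
have E_lt : E < 2 ^ L.
  case/andP: hL => _; apply: leq_ltn_trans; apply: leq_trans zn; apply: leq_trans (ltnW large).
  by rewrite -mulnn mulnA leq_pmull // muln_gt0 E0 expn_gt0 L0.
(* Chebyshev's bound with h = 8 L: 2 h w <= 64 L^3 E <= 2^(4 L + 6) <= 2^(8 L), since E < 2^L and L
   >= 2. *)
have hx0 : w <= size (prime_list (8 * L * w).*2.+1).
  rewrite /prime_list size_filter; apply: leq_count_prime => //.
    by rewrite muln_gt0 L0.
  have h64 : (8 * L * w).*2 <= 2 ^ 6 * (2 ^ L * 2 ^ L * 2 ^ L * 2 ^ L).
    apply: (@leq_trans (2 ^ 6 * (L * L * L * E))).
      by move: w_le; rewrite -mulnn; clear; move: w E L => v e l; nia.
    by rewrite leq_mul2l; apply/orP; right; rewrite !leq_mul // ltnW.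
  apply: leq_trans h64 _; rewrite -!expnD leq_exp2l //; lia.
have hx : exists X, w <= size (prime_list X) by eexists; exact: hx0.
have [X [hX1 hX2 X_le]] : exists X, [/\ w <= size (prime_list X),
    forall Y, Y < X -> size (prime_list Y) < w & X <= (8 * L * w).*2.+1].
  have [X h1 h2] := ex_minnP hx; exists X; split=> //; last exact: h2.
  by move=> Y YX; rewrite ltnNge; apply: contraL YX => /h2; rewrite -leqNgt.
have hd : exists d, 2 * k <= 2 ^ d by exists (2 * k); apply: ltnW (ltn_expl _ _).
have [d kd hd2] : exists2 d, 2 * k <= 2 ^ d & forall i, i < d -> 2 ^ i < 2 * k.
  have [d h1 h2] := ex_minnP hd; exists d => // i id.
  by rewrite ltnNge; apply: contraL id => /h2; rewrite -leqNgt.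
have d_lt : 2 ^ d < 4 * k.
  move: hd2 k0; case: (d) => [|d'] h k1; first by rewrite expn0; lia.
  by rewrite expnS; have := h d' (ltnSn _); lia.
have nL : n < 2 ^ L by case/andP: hL.
have dL : d <= L.+1.
  rewrite -ltnS -(@ltn_exp2l 2) // !expnS; move: d_lt nL kn.
  by move: (2 ^ d) (2 ^ L); clear; lia.
have zB : z * 2 ^ d + z <= 4 * n by rewrite en addnC -mulnS mulnCA leq_mul2l d_lt orbT.
have zd : z * 2 ^ d + 1 < 2 ^ L.+3.
  by rewrite !expnS; move: zB nL z0; move: (z * 2 ^ d) (2 ^ L); clear; lia.
set A := L ^ 2 * E; have A0 : 0 < A by rewrite /A muln_gt0 expn_gt0 L0.
have LA : L <= A by rewrite /A -mulnn -mulnA leq_pmulr // muln_gt0 L0.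
have X_le2 : X <= 68 * (L * A).
  apply: leq_trans X_le _; rewrite -/A in w_le.
  have : L * w <= L * (4 * A) by rewrite leq_mul2l w_le orbT.
  have : 0 < L * A by rewrite muln_gt0 L0.
  by rewrite mulnCA -mulnA; move: (L * w) (L * A); clear; lia.
pose IN := 4 + z + n; pose HD := 3 * IN; pose PR := HD + n; pose TB := PR + w.
pose OUT := TB + z * (2 * 2 ^ d); pose s := OUT + n * w.
pose l := 2 * 2 ^ d * w * X.
(* Up to constants, w is A and X is L A. Their product L A^2 gives the length per bucket, and it is
   also the threshold for z. *)
have A_E5 : A * (L * A) * L ^ 0 = L ^ 5 * E ^ 2.
  by rewrite /A !expnS !expn0; clear; lia.
have s_le : s <= 50 * (n * A).
  have h1 : n * w <= n * (4 * A) by rewrite leq_mul2l w_le orbT.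
  have h2 : n <= n * A by rewrite leq_pmulr.
  have h3 : A <= n * A by rewrite leq_pmull.
  rewrite /s /OUT /TB /PR /HD /IN mulnCA; move: h1 h2 h3 w_le zB zn n0; rewrite -/A mulnCA.
  by move: (n * A) (z * 2 ^ d) (n * w); clear; lia.
(* 2176 = 2 * 4 * 4 * 68, from 2^d < 4 k, w <= 4 A and X <= 68 L A. *)
have l_le : l <= 2176 * (k * L ^ 5 * E ^ 2).
  rewrite -mulnA -A_E5 expn0 muln1 /l.
  apply: (@leq_trans (2 * (4 * k) * (4 * A) * (68 * (L * A)))).
    by apply: leq_mul => //; apply: leq_mul => //; apply: leq_mul => //; exact: ltnW.
  by move: (L * A); clear; lia.
have pow2 c : 2 ^ c <= G ^ c by case: c => [|c] //; rewrite leq_exp2r.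
have LG : L <= G by apply: leq_trans Ln (leq_addr _ _).
have EG : E <= G by apply: leq_addl.
have nG : n <= G by apply: leq_addr.
have sM : s < 2 ^ W.
  apply: (@W_large _ 11) => //; apply: (@leq_ltn_trans (G ^ 10)); last by rewrite ltn_exp2l.
  apply: leq_trans s_le _; rewrite (_ : 10 = 6 + (1 + (2 + 1))) // !expnD !expn1.
  apply: leq_mul; first by apply: leq_trans (pow2 6).
  by rewrite !leq_mul // leq_exp2r.
have lM : l < 2 ^ W.
  apply: (@W_large _ 21) => //; apply: (@leq_ltn_trans (G ^ 20)); last by rewrite ltn_exp2l.
  apply: leq_trans l_le _; rewrite (_ : 20 = 12 + (1 + 5 + 2)) // !expnD !expn1.
  apply: leq_mul; first by apply: leq_trans (pow2 12).
  by rewrite !leq_mul // ?leq_exp2r // (leq_trans kn).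
have [sX X2] := prime_list_size_min w0 hX1 hX2.
have XM : X < 2 ^ W.
  by apply: leq_ltn_trans lM; rewrite /l leq_pmull // !muln_gt0 expn_gt0 w0.
have lens i : i < z -> size (nth [::] Ls i) <= k by move=> iz; apply/Ls_k/Ls_mem.
have uniqs i : i < z -> uniq (nth [::] Ls i) by move=> iz; apply/Ls_uniq/Ls_mem.
have lts i v : i < z -> v \in nth [::] Ls i -> v < n by move=> iz; apply/Ls_lt/Ls_mem.
(* 702 = 200 + 500 + 2: input and logarithm, the fixed costs of [prog_code], and the jump over the
   other branch. *)
have [t [st [run [m0 m1 m2 em ht]]]] : wp W s prog (fun T st => [/\ st.2 0 = w, st.2 1 = l, st.2 2 = OUT,
    emitted z d w OUT X Ls st.2 n
    & T <= 702 + L * 20 + d * 20 + X * (X * 20 + 100) + IN * 100 +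
       n * (120 + d * 60 + w * 40) + z * k * (100 + d * 80)]) 0 (fun=> 0, nth 0 input).
  apply: wp_prog; [by rewrite /s /OUT /TB /PR /HD /IN; lia| |]; last first.
    by move=> small; move: (leq_trans large small); rewrite ltnn.
  move=> _ f hf T hT.
  apply: (@wp_code W s z n d w IN HD PR TB OUT X erefl erefl erefl erefl erefl erefl
    (ltnW sM) XM z0 n0 w0 Ls (input_pos Ls) _ pos_le _ lts uniqs k kd lens lM E L) hf _ _ _ _ => //.
  - by rewrite /input_pos take0.
  - by move=> i iz; rewrite input_posS ?sLs.
  - by move=> i iz; have := @nth_input_words z k a b Ls i 0; rewrite sLs addn0 /= => ->.
  - move=> i j iz js; have := @nth_input_words z k a b Ls i j.+1; rewrite sLs /= => <- //.
    by rewrite addn1 addSnnS.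
  - move=> c hc; rewrite nth_default // size_input_words sLs; exact: leq_trans pos_le hc.
  move=> f' m' T' h0 h1 h2 hem hT'; split=> //.
  by move: hT hT'; clear; lia.
have [|cf [hc hm]] := exec_computes _ run.
  rewrite (ltnW sM) size_input_words sLs andbT; apply: leq_trans pos_le _.
  by rewrite /s /OUT /TB /PR /HD /IN; lia.
exists w, l, t, s, (code z d w X Ls), cf; split.
- split=> //; rewrite hm; first by split=> //; rewrite ?m2 ?/s //; rewrite /OUT /TB /PR /HD /IN; lia.
  by move=> u j un jw; rewrite m2; apply: em.
- split=> [u j un jw|u j j' un jw jw' e]; first by have [] := code_lt z d Ls u hX1 jw.
  by have [] := code_inj sX jw jw' e.
- move=> i u iz un ui; rewrite mulnC [X in _ <= X]ew leq_mul2l; apply/orP; right.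
  apply: leq_trans (collisions_le sX nL kd zd lts uniqs lens iz un ui) _.
  by rewrite mulnC leq_mul2l; apply/orP; right; rewrite addn3.
have nA : n * L ^ 2 * E = n * A by rewrite /A mulnA.
rewrite nA -/A; rewrite -/A in w_le.
split.
- by move: w_le; rewrite /million -lock; move: (A); clear; lia.
- by move: l_le; rewrite /million -lock; move: (k * L ^ 5 * E ^ 2); clear; lia.
(* Trial division is affordable: (68 L A)^2 = 4624 L * (L^5 E^2), where L^5 E^2 < z <= n and L <=
   A. *)
- have XX : X * X <= 4624 * (n * A).
    apply: (@leq_trans ((68 * (L * A)) * (68 * (L * A)))); first exact: leq_mul.
    apply: (@leq_trans (4624 * (L * (A * (L * A) * L ^ 0)))).
      by rewrite expn0; move: (A) (L); clear => c e; lia.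
    rewrite A_E5 leq_mul2l; apply/orP; right; rewrite mulnC.
    by apply: leq_mul LA; apply: leq_trans (ltnW large) zn.
  have h1 : n * w <= n * (4 * A) by rewrite leq_mul2l w_le orbT.
  have h2 : n <= n * A by rewrite leq_pmulr.
  have h3 : n * L <= n * A by rewrite leq_mul2l LA orbT.
  have h4 : n * d <= n * L.+1 by rewrite leq_mul2l dL orbT.
  have h5 : X <= X * X by rewrite leq_pmulr //; lia.
  rewrite add0n -en /IN in ht; rewrite /million -lock.
  by move: ht XX h1 h2 h3 h4 h5 zn n0 Ln dL; move: (A); clear; lia.
by move: s_le; rewrite /million -lock; move: (n * A); clear; lia.
Qed.

End Correctness.

(** * Real bounds *)

Lemma solvedP W z k a b n L E Ls : 0 < z -> 0 < k -> n = z * k -> size Ls = z ->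
  (forall r, r \in Ls -> size r <= k) -> (forall r, r \in Ls -> uniq r) ->
  (forall r v, r \in Ls -> v \in r -> v < n) -> E = b %/ a + 1 ->
  2 ^ L.-1 <= n < 2 ^ L -> b < 2 ^ W ->
  (forall x c, c <= 30 -> x < (n + E) ^ c -> x < 2 ^ W) ->
  exists w l t s cd cf, solved W z k a b n L E Ls w l t s cd cf.
Proof.
move=> *; case: (leqP z (L ^ 5 * E ^ 2)) => h.
  exact: solved_small h.
exact: solved_large h.
Qed.

Lemma rank_word_lt (U : finType) (u : U) : rank_word u < #|U|.
Proof. by rewrite /rank_word; case: (enum_rank u). Qed.

Definition codeword (w l : nat) (g : nat -> nat) : {set 'I_l} :=
  [set x | nat_of_ord x \in [seq g j | j <- iota 0 w]].

Lemma in_codeword w l g (x : 'I_l) :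
  (x \in codeword w l g) = (nat_of_ord x \in [seq g j | j <- iota 0 w]).
Proof. by rewrite in_set. Qed.

Lemma enum_codeword w l g : (forall j, j < w -> g j < l) ->
  (forall j j', j < w -> j' < w -> g j = g j' -> j = j') ->
  perm_eq [seq g j | j <- iota 0 w] [seq nat_of_ord x | x <- enum (codeword w l g)].
Proof.
move=> lt inj; apply: uniq_perm.
- rewrite map_inj_in_uniq ?iota_uniq // => j j'; rewrite !mem_iota => jw jw'.
  exact: inj.
- by rewrite map_inj_uniq ?enum_uniq //; apply: ord_inj.
move=> x; apply/idP/mapP => [|[y]]; last by rewrite mem_enum in_codeword => hy ->.
case/mapP=> j; rewrite mem_iota => /andP[_ jw] ->.
by exists (Ordinal (lt j jw)) => //; rewrite mem_enum in_codeword /= map_f // mem_iota.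
Qed.

Lemma card_codewordI w l g (V : {set 'I_l}) (bad : pred nat) :
  (forall j (x : 'I_l), j < w -> x = g j :> nat -> x \in V -> bad j) ->
  #|codeword w l g :&: V| <= count bad (iota 0 w).
Proof.
move=> hbad; rewrite cardE -(size_map (@nat_of_ord l)) -size_filter
  -[X in _ <= X](size_map g).
apply: uniq_leq_size; first by rewrite map_inj_uniq ?enum_uniq //; apply: ord_inj.
move=> _ /mapP[x + ->]; rewrite mem_enum in_setI in_codeword => /andP[/mapP[j jw e] xV].
rewrite e map_f // mem_filter jw andbT.
by apply: hbad e xV; move: jw; rewrite mem_iota.
Qed.

Local Open Scope ring_scope.

Section Reals.
Variable R : realType.
Implicit Types x eps : R.

Let ln2_gt0 : 0 < ln (2%:R : R).
Proof. by rewrite ln_gt0 // ltr1n. Qed.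

Lemma leq_pow2_log2 x (p c W : nat) : 1 <= x ->
  (c%:R * log2 x <= W%:R -> p%:R <= x ^+ c -> (p <= 2 ^ W)%N).
Proof.
move=> x1; rewrite /log2 mulrA ler_pdivrMr // => hW hp.
have x0 : 0 < x by apply: lt_le_trans x1.
rewrite -(ler_nat R) natrX; apply: le_trans hp _.
rewrite -ler_ln ?posrE ?exprn_gt0 // !lnXn ?ltr0n //.
by rewrite -[X in X <= _]mulr_natl -[X in _ <= X]mulr_natl.
Qed.

Lemma pow2_le_log2 (p n : nat) : (2 ^ p <= n)%N -> p%:R <= log2 (n%:R : R).
Proof.
move=> h; have n0 : (0 < n)%N by apply: leq_trans h; rewrite expn_gt0.
rewrite /log2 ler_pdivlMr // mulr_natl -lnXn ?ltr0n //.
by rewrite ler_ln ?posrE ?exprn_gt0 ?ltr0n // -natrX ler_nat.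
Qed.

(** E exceeds b / a by at most 1, and b / a lies between 1 / eps and 2 / eps. *)
Lemma fraction_bounds eps (a b : nat) : 0 < eps -> eps / 2%:R <= a%:R / b%:R <= eps ->
  let E := (b %/ a + 1)%N in 1 <= eps * E%:R /\ E%:R <= 2%:R / eps + 1.
Proof.
move=> e0 /andP[h1 h2] E.
have ab0 : 0 < a%:R / b%:R :> R by apply: lt_le_trans h1; rewrite divr_gt0 ?ltr0n.
(* Since x / 0 = 0, positivity of the fraction excludes a = 0 and b = 0. *)
have b0 : (0 < b)%N by case: (b) ab0 => //; rewrite invr0 mulr0 ltxx.
have a0 : (0 < a)%N by case: (a) ab0 => //; rewrite mul0r ltxx.
have bR : 0 < b%:R :> R by rewrite ltr0n.
have aR : 0 < a%:R :> R by rewrite ltr0n.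
split.
  apply: le_trans (ler_wpM2r (ler0n _ _) h2).
  rewrite mulrAC ler_pdivlMr // mul1r -natrM ler_nat /E addn1 mulnC.
  exact: ltnW (ltn_ceil _ a0).
rewrite /E natrD lerD2r.
have : (b %/ a)%:R * a%:R <= b%:R :> R by rewrite -natrM ler_nat leq_divM.
move: h1; rewrite ler_pdivlMr // mulrAC ler_pdivrMr ?ltr0n // => h1 h3.
rewrite ler_pdivlMr //.
rewrite -(ler_pM2r aR).
have : (b %/ a)%:R * a%:R * eps <= b%:R * eps by rewrite ler_wpM2r // ltW.
by move=> h4; lra.
Qed.

(** If c positions are bad, then c E <= w and 1 <= eps E give c <= eps w. *)
Lemma superimposed_codewords (U : finType) (z w l E : nat) (S : 'I_z -> {set U})
    eps (g : U -> nat -> nat) :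
  0 < eps -> 1 <= eps * E%:R ->
  (forall u j, (j < w)%N -> (g u j < l)%N) ->
  (forall u j j', (j < w)%N -> (j' < w)%N -> g u j = g u j' -> j = j') ->
  (forall i u, u \notin S i ->
    (count (fun j => [exists v in S i, has (fun j' => g u j == g v j') (iota 0 w)])
      (iota 0 w) * E <= w)%N) ->
  superimposed_code w S ((1 - eps) * w%:R) (fun u => codeword w l (g u)).
Proof.
move=> e0 eE lt inj hbad.
have card u : #|codeword w l (g u)| = w.
  rewrite cardE -(size_map (@nat_of_ord l)).
  by rewrite -(perm_size (enum_codeword (lt u) (inj u))) size_map size_iota.
split=> // i u ui; have := hbad i u ui.
set V := \bigcup_(v in S i) _; set c := count _ _ => hc.
have cV : (#|codeword w l (g u) :&: V| <= c)%N.
  apply: card_codewordI => j x jw e /bigcupP[v vS]; rewrite in_codeword => /mapP[j' j'w e'].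
  by apply/existsP; exists v; rewrite vS; apply/hasP; exists j' => //; rewrite -e -e'.
have : (w <= #|codeword w l (g u) :\: V| + c)%N.
  by rewrite -{1}(card u) -(cardsID V) addnC leq_add2l.
rewrite -(ler_nat R) natrD => h; rewrite mulrBl mul1r lerBlDr; apply: le_trans h _.
rewrite lerD2l; have hcR : c%:R * E%:R <= w%:R :> R by rewrite -natrM ler_nat.
apply: le_trans (_ : eps * (c%:R * E%:R) <= _); last by rewrite ler_pM2l.
by rewrite mulrCA -{1}[c%:R]mulr1 ler_wpM2l.
Qed.

End Reals.

Theorem theorem2p10 (R : realType) :
  exists (P : program) (c0 c : nat),
  forall (U : finType) (z k : nat) (S : 'I_z -> {set U}) (eps : R)
         (L : 'I_z -> seq U) (a b W : nat),
    (1 <= z)%N -> (1 <= k)%N -> #|U| = (z * k)%N ->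
    (forall i, (#|S i| <= k)%N) ->
    0 < eps < 1 ->
    (* representation of the input *)
    (forall i, perm_eq (L i) (enum (S i))) ->
    (a < 2 ^ W)%N -> (b < 2 ^ W)%N -> eps / 2%:R <= a%:R / b%:R <= eps ->
    (* word size Omega(log (|U| / eps)) *)
    c0%:R * log2 (2%:R * #|U|%:R / eps) <= W%:R ->
  exists (w l : nat) (C : U -> {set 'I_l}) (t s : nat) (cf : config),
    [/\ (0 < w)%N,
        superimposed_code w S ((1 - eps) * w%:R) C,
        computes W s t P (code_input k a b L) cf,
        code_output s w C cf
      & (1 < #|U|)%N ->
        let n : R := #|U|%:R in
        [/\ w%:R <= c%:R * (eps^-1 * log2 n ^+ 2),
            l%:R <= c%:R * (eps^-1 ^+ 2 * k%:R * log2 n ^+ 5),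
            t%:R <= c%:R * (eps^-1 * n * log2 n ^+ 2)
          & s%:R <= c%:R * (eps^-1 * n * log2 n ^+ 2)]].
Proof.
(* 60 = 2 * 30, as powers of n + E <= (2 n / eps)^2 with exponents up to 30 must fit a word. 288 =
   2^5 * 3^2 comes from L^5 E^2 in the length, where L <= 2 log n and E <= 3 / eps. *)
exists (compile prog 0), 60%N, (288 * million)%N.
move=> U z k S eps L a b W z0 k0 en hS /andP[e0 e1] hL aW bW hab hW.
have [eE Ele] := fraction_bounds e0 hab; set E := (b %/ a + 1)%N in eE Ele.
set n := #|U| in en hW *.
have n0 : (0 < n)%N by rewrite en muln_gt0 z0.
have E0 : (0 < E)%N by rewrite /E addn1.
set Lg := (trunc_log 2 n).+1.
have hLg : (2 ^ Lg.-1 <= n < 2 ^ Lg)%N by rewrite trunc_logP //= trunc_log_ltn.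
pose Ls := [seq [seq rank_word u | u <- L i] | i <- enum 'I_z].
have sLs : size Ls = z by rewrite size_map size_enum_ord.
have nthLs (i : 'I_z) : nth [::] Ls i = [seq rank_word u | u <- L i].
  by rewrite (nth_map i) ?size_enum_ord // nth_ord_enum.
have rank_inj : injective (@rank_word U).
  by move=> u v /ord_inj /enum_rank_inj.
have LsP r : r \in Ls -> exists i, r = [seq rank_word u | u <- L i].
  by case/mapP=> i _ ->; exists i.
have rinv : 0 < eps^-1 by rewrite invr_gt0.
have einv : 1 <= eps^-1 by rewrite invf_ge1 // ltW.
have nR : 1 <= n%:R :> R by rewrite ler1n.
set N2 := 2%:R * n%:R / eps in hW.
have N2_ge : 2%:R * n%:R <= N2 by rewrite /N2 ler_peMr // mulr_ge0.
have N2_gee : 2%:R / eps <= N2 by rewrite /N2 ler_pM2r // ler_peMr.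
(* n + E <= N2^2 follows from 2 n <= N2, E <= N2 + 1 and N2 >= 2. *)
have large x c : (c <= 30)%N -> (x < (n + E) ^ c)%N -> (x < 2 ^ W)%N.
  move=> c30 /leq_trans; apply.
  have N21 : 1 <= N2 by lra.
  apply: (leq_pow2_log2 N21 hW); rewrite natrX natrD.
  apply: (@le_trans _ _ ((N2 ^+ 2) ^+ c)).
    apply: lerXn2r; rewrite ?nnegrE ?addr_ge0 ?ler0n ?exprn_ge0 //; first lra.
    by rewrite expr2; nra.
  by rewrite -exprM; apply: ler_weXn2l => //; exact: leq_mul (leqnn 2) c30.
have [|||w [l [t [s [cd [cf hsol]]]]]] :=
    solvedP (a := a) z0 k0 en sLs _ _ _ erefl hLg bW large.
- move=> r /LsP[i ->]; rewrite size_map (perm_size (hL i)) -cardE; exact: hS.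
- by move=> r /LsP[i ->]; rewrite (map_inj_uniq rank_inj) (perm_uniq (hL i)) enum_uniq.
- by move=> r v /LsP[i ->] /mapP[u _ ->]; apply: rank_word_lt.
case: hsol => [[w0 hcomp [m0 m1 s3 ms]] hmem] [cd_lt cd_inj] hbad [bw bl bt bs].
have rank_lt (u : U) : (rank_word u < n)%N by apply: rank_word_lt.
exists w, l, (fun u => codeword w l (cd (rank_word u))), t, s, cf; split=> //.
- apply: (superimposed_codewords (E := E) e0 eE).
  + by move=> u j jw; apply: cd_lt.
  + by move=> u j j' jw jw'; apply: cd_inj.
  move=> i u ui; have := hbad i (rank_word u) (ltn_ord i) (rank_lt u).
  rewrite nthLs (mem_map rank_inj) (perm_mem (hL i)) mem_enum ui => /(_ isT).
  apply: leq_trans; rewrite leq_mul2r; apply/orP; right; apply: sub_count => j.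
  case/existsP=> v /andP[vS hv]; apply/hasP; exists (rank_word v) => //.
  by rewrite (mem_map rank_inj) (perm_mem (hL i)) mem_enum.
- rewrite (_ : code_input k a b L = input_words z k a b Ls) //.
  rewrite /code_input /input_words /Ls -map_comp; congr (_ ++ flatten _).
  by apply: eq_map => i /=; rewrite size_map.
- split=> // u.
  have -> : [seq memory cf (memory cf 2 + rank_word u * w + j)%N | j <- iota 0 w] =
      [seq cd (rank_word u) j | j <- iota 0 w].
    by apply/eq_in_map => j; rewrite mem_iota => jw; apply: hmem.
  by apply: enum_codeword => [j jw|j j' jw jw']; [exact: cd_lt|exact: cd_inj].
move=> n2 nr; set lg := log2 nr; set M : R := million%:R; set r := eps^-1.
have M0 : 0 <= M by apply: ler0n.
(* For |U| >= 2 the logarithm is at least 1 and absorbs the 1 in L = floor(log n) + 1. *)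
have lg1 : 1 <= lg by apply: (@pow2_le_log2 R 1 n).
have lg0 : 0 <= lg by apply: le_trans lg1.
have Lg_le : Lg%:R <= 2%:R * lg.
  have : Lg.-1%:R <= lg by apply: pow2_le_log2; case/andP: hLg.
  by rewrite -[Lg]addn1 addn1 /= -natr1; lra.
have E_le : E%:R <= 3%:R * r by rewrite /r; lra.
have r0 : 0 <= r by apply: ltW.
have cM : (288 * million)%N%:R = 288%:R * M by rewrite natrM.
have LgX c : Lg%:R ^+ c <= 2%:R ^+ c * lg ^+ c.
  by rewrite -exprMn lerXn2r // nnegrE ?ler0n // mulr_ge0.
have LE2 : Lg%:R ^+ 2 * E%:R <= 288%:R * (r * lg ^+ 2).
  apply: (@le_trans _ _ ((2%:R ^+ 2 * lg ^+ 2) * (3%:R * r))).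
    by apply: ler_pM => //; rewrite ?exprn_ge0 ?ler0n.
  have : 0 <= r * lg ^+ 2 by rewrite mulr_ge0 ?exprn_ge0.
  by lra.
have toR (x y : nat) : (x <= million * y)%N -> x%:R <= M * y%:R.
  by rewrite -(ler_nat R) natrM.
have nLE : (n * Lg ^ 2 * E)%N%:R <= 288%:R * (r * nr * lg ^+ 2).
  rewrite natrM (natrM _ n (Lg ^ 2)%N) natrX -mulrA; have := ler_wpM2l (ler0n R n) LE2.
  by rewrite -/nr; lra.
rewrite cM -!mulrA ![288%:R * (M * _)]mulrCA; split.
- apply: le_trans (toR _ _ bw) _; rewrite ler_wpM2l // natrM natrX.
  by apply: le_trans LE2 _; lra.
- apply: le_trans (toR _ _ bl) _; rewrite ler_wpM2l //.
  rewrite natrM (natrM _ k (Lg ^ 5)%N) !natrX.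
  have h5 : Lg%:R ^+ 5 * E%:R ^+ 2 <= (2%:R ^+ 5 * lg ^+ 5) * (3%:R * r) ^+ 2.
    apply: ler_pM; rewrite ?exprn_ge0 ?ler0n //.
    by rewrite lerXn2r // nnegrE ?ler0n // mulr_ge0.
  have := ler_wpM2l (ler0n R k) h5; rewrite exprMn => h.
  rewrite -mulrA; apply: le_trans h _.
  by lra.
- apply: le_trans (toR _ _ bt) _; rewrite ler_wpM2l //.
  by apply: le_trans nLE _; lra.
apply: le_trans (toR _ _ bs) _; rewrite ler_wpM2l //.
by apply: le_trans nLE _; lra.
Qed.
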